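(* All NP properties of teams are expressible in independence logic. That is: let $\sigma$ be a finite first order signature, let $k\geq 1$, and let $\mathcal C$ be a class of pairs $(M,R)$, where $M$ is a finite $\sigma$-model and $R\subseteq \mathrm{Dom}(M)^k$, which is closed under isomorphism and such that membership in $\mathcal C$ is decidable in NP. Let $\vec v$ be a tuple of $k$ distinct variables. Then there exists an independence logic formula $\phi(\vec v)$ over $\sigma$, with free variables in $\vec v$, such that $$M\models_X\phi(\vec v) \Leftrightarrow (M,\mathrm{Rel}_{\vec v}(X))\in\mathcal C$$ for all finite $\sigma$-models $M$ and all teams $X$ over $M$ whose domain contains $\vec v$.
   Context: All first order models are assumed to have at least two elements in their domain; $\mathrm{Dom}(M)$ is the domain of $M$. An assignment over $M$ is a function from a set of variables to $\mathrm{Dom}(M)$; $s[m/x]$ is the assignment which sends $x$ to $m$ and otherwise agrees with $s$; $t\langle s\rangle$ is the value of the term $t$ in $M$ under $s$, and $\vec t\langle s\rangle$ is the corresponding tuple of values. A team $X$ over $M$ is a set of assignments over $M$ all having the same domain, called the domain of $X$. For a tuple of variables $\vec v = v_1\ldots v_k$ in the domain of $X$, $\mathrm{Rel}_{\vec v}(X) = \{(s(v_1),\ldots,s(v_k)) : s\in X\}$. Independence logic formulas are in negation normal form and are built from first order literals and independence atoms $\vec t_2 ~\bot_{\vec t_1}~ \vec t_3$ (with $\vec t_1,\vec t_2,\vec t_3$ finite, possibly empty, tuples of terms, not necessarily of the same length) using $\wedge,\vee,\exists x,\forall x$. The satisfaction relation $M\models_X\phi$ (lax team semantics), where the domain of $X$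 contains the free variables of $\phi$, is: - for a first order literal $\phi$: $M\models_s\phi$ (Tarski) for all $s\in X$; - $M\models_X \vec t_2 ~\bot_{\vec t_1}~ \vec t_3$ iff for all $s,s'\in X$ with $\vec t_1\langle s\rangle=\vec t_1\langle s'\rangle$ there is $s''\in X$ with $\vec t_1\langle s''\rangle\vec t_2\langle s''\rangle=\vec t_1\langle s\rangle\vec t_2\langle s\rangle$ and $\vec t_1\langle s''\rangle\vec t_3\langle s''\rangle=\vec t_1\langle s'\rangle\vec t_3\langle s'\rangle$; - $M\models_X\psi\vee\theta$ iff $X=Y\cup Z$ for some teams $Y,Z$ with $M\models_Y\psi$ and $M\models_Z\theta$; - $M\models_X\psi\wedge\theta$ iff $M\models_X\psi$ and $M\models_X\theta$; - $M\models_X\exists x\psi$ iff there is $H:X\to\mathcal P(\mathrm{Dom}(M))\setminus\{\emptyset\}$ with $M\models_{X[H/x]}\psi$, where $X[H/x]=\{s[m/x]:s\in X,\ m\in H(s)\}$; - $M\models_X\forall x\psi$ iff $M\models_{X[M/x]}\psi$, where $X[M/x]=\{s[m/x]:s\in X,\ m\in\mathrm{Dom}(M)\}$.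
   Formalization: The empty team satisfies every independence logic formula, so the claim fails for X = ∅ when (M, ∅) is not in C (e.g. C empty); the formal statement therefore assumes that X is nonempty or (M, ∅) belongs to C. *)

(* Defs.v *)
From mathcomp Require Import all_boot ssralg poly.
From mathcomp Require Import boolp classical_sets.

Set Implicit Arguments.
Unset Strict Implicit.
Unset Printing Implicit Defensive.

Local Open Scope classical_set_scope.

(* * Finite signatures and finite models *)

(* Constants are function symbols of arity 0. *)
Record signature := Signature {
  fsym : finType;
  farity : fsym -> nat;
  rsym : finType;
  rarity : rsym -> nat }.

Record finModel (sg : signature) := FinModel {
  dom :> finType;
  dom_gt1 : 1 < #|dom|;
  finterp : forall f : fsym sg, (farity f).-tuple dom -> dom;
  rinterp : forall r : rsym sg, set ((rarity r).-tuple dom) }.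

(* * Syntax of independence logic; variables are natural numbers *)

Inductive term (sg : signature) : Type :=
| Var of nat
| App (f : fsym sg) of ('I_(farity f) -> term sg).

Inductive atom (sg : signature) : Type :=
| AEq of term sg & term sg
| ARel (r : rsym sg) of ('I_(rarity r) -> term sg).

(* [Indep t2 t1 t3] is the independence atom of t2 and t3 given t1. *)
Inductive formula (sg : signature) : Type :=
| Pos of atom sg
| Neg of atom sg
| Indep of seq (term sg) & seq (term sg) & seq (term sg)
| And of formula sg & formula sg
| Or of formula sg & formula sg
| Ex of nat & formula sg
| All of nat & formula sg.

Fixpoint term_fv sg (t : term sg) : set nat :=
  match t with
  | Var x => [set x]
  | App f ts => \bigcup_i term_fv (ts i)
  end.

Definition atom_fv sg (a : atom sg) : set nat :=
  match a with
  | AEq t u => term_fv t `|` term_fv u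
  | ARel r ts => \bigcup_i term_fv (ts i)
  end.

Definition terms_fv sg (ts : seq (term sg)) : set nat :=
  foldr (fun t A => term_fv t `|` A) set0 ts.

Fixpoint formula_fv sg (phi : formula sg) : set nat :=
  match phi with
  | Pos a | Neg a => atom_fv a
  | Indep t2 t1 t3 => terms_fv t2 `|` terms_fv t1 `|` terms_fv t3
  | And psi theta | Or psi theta => formula_fv psi `|` formula_fv theta
  | Ex x psi | All x psi => formula_fv psi `\ x
  end.

(* * Lax team semantics *)

(* An assignment is a partial function from variables; [s x = None] means that
   x is not in the domain of s. *)
Definition assignment (D : Type) := nat -> option D.

Definition update D (s : assignment D) (x : nat) (m : D) : assignment D :=
  fun y => if y == x then Some m else s y.

Definition team_on D (V : set nat) (X : set (assignment D)) : Prop :=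
  forall s, X s -> forall x, s x <> None <-> V x.

Definition team_rel D k (v : k.-tuple nat) (X : set (assignment D)) :
    set (k.-tuple D) :=
  [set a | exists2 s, X s & forall i, s (tnth v i) = Some (tnth a i)].

(* [Some] of the tuple of values when all of them are defined; otherwise [pmap]
   yields a list that is too short, and the result is [None]. *)
Definition opt_tuple D n (g : 'I_n -> option D) : option (n.-tuple D) :=
  insub (pmap g (enum 'I_n)).

Section Semantics.
Variables (sg : signature) (M : finModel sg).
Implicit Types (s : assignment M) (X : set (assignment M)).

(* The value is [None] iff some variable of the term is outside the domain of
   the assignment. *)
Fixpoint eval s (t : term sg) : option M :=
  match t with
  | Var x => s x
  | App f ts => omap (@finterp sg M f) (opt_tuple (fun i => eval s (ts i)))
  end.

(* Only meaningful, like [sat] below, when the free variables are in the domain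
   of the assignment. *)
Definition atom_true s (a : atom sg) : Prop :=
  match a with
  | AEq t u => eval s t = eval s u
  | ARel r ts => exists2 d, rinterp d
                         & opt_tuple (fun i => eval s (ts i)) = Some d
  end.

Fixpoint sat X (phi : formula sg) : Prop :=
  match phi with
  | Pos a => forall s, X s -> atom_true s a
  | Neg a => forall s, X s -> ~ atom_true s a
  | Indep t2 t1 t3 =>
      forall s s', X s -> X s' -> map (eval s) t1 = map (eval s') t1 ->
      exists s'', [/\ X s'',
        map (eval s'') (t1 ++ t2) = map (eval s) (t1 ++ t2) &
        map (eval s'') (t1 ++ t3) = map (eval s') (t1 ++ t3)]
  | And psi theta => sat X psi /\ sat X theta
  | Or psi theta => exists Y Z, [/\ X = Y `|` Z, sat Y psi & sat Z theta]
  | Ex x psi => exists2 H : assignment M -> set M,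
      forall s, X s -> H s !=set0 &
      sat [set s' | exists s m, [/\ X s, H s m & s' = update s x m]] psi
  | All x psi => sat [set s' | exists s m, X s /\ s' = update s x m] psi
  end.

Lemma sat_empty (phi : formula sg) : sat set0 phi.
Proof.
have E (P : assignment M -> M -> assignment M -> Prop) :
    (forall s m s', P s m s' -> False) -> [set s' | exists s m, P s m s'] = set0.
  by move=> h; apply/seteqP; split=> // s' [s [m /h]].
elim: phi => //= [psi IHpsi theta IHtheta|x psi IH|x psi IH].
- by exists set0, set0; rewrite setU0.
- by exists (fun=> setT); rewrite // E // => s m s' [].
- by rewrite E // => s m s' [].
Qed.

End Semantics.

(* * Nondeterministic Turing machines and NP *)

Inductive move := MoveL | MoveR.

(* Tape alphabet: [None] is the blank, [inl] embeds the input alphabet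
   {0, 1}, and [inr] the further working symbols. *)
Definition tape_symbol (W : finType) : Type := option (bool + W).

Record ntm := NTM {
  ntm_state : finType;
  ntm_work : finType;
  ntm_start : ntm_state;
  ntm_accept : pred ntm_state;
  ntm_delta : ntm_state -> tape_symbol ntm_work ->
              pred (ntm_state * tape_symbol ntm_work * move) }.

(* The tape is infinite to the right only. *)
Record config (N : ntm) := Config {
  cstate : ntm_state N;
  ctape : nat -> tape_symbol (ntm_work N);
  chead : nat }.

Definition init_config (N : ntm) (w : seq bool) : config N :=
  Config (ntm_start N) (nth None [seq Some (inl b) | b <- w]) 0.

(* Moving left from cell 0 leaves the head there. *)
Definition step (N : ntm) (c c' : config N) : Prop :=
  exists q a d,
    ntm_delta (cstate c) (ctape c (chead c)) (q, a, d) /\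
    c' = Config q
           (fun i => if i == chead c then a else ctape c i)
           (match d with MoveL => (chead c).-1 | MoveR => (chead c).+1 end).

Fixpoint steps (N : ntm) (t : nat) (c c' : config N) : Prop :=
  match t with
  | 0 => c = c'
  | t'.+1 => exists2 c1, step c c1 & steps t' c1 c'
  end.

(* Every computation branch, accepting or not, obeys the time bound. *)
Definition runs_in_time (N : ntm) (T : nat -> nat) : Prop :=
  forall w t c, steps t (init_config N w) c -> t <= T (size w).

Definition accepts (N : ntm) (w : seq bool) : Prop :=
  exists t c, steps t (init_config N w) c /\ ntm_accept (cstate c).

Definition NP (L : set (seq bool)) : Prop :=
  exists (N : ntm) (p : {poly nat}),
    runs_in_time N (fun n => p.[n]%R) /\ forall w, L w <-> accepts N w.

(* * Classes of pairs (M, R) and their decision problems *)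

Definition team_property (sg : signature) (k : nat) :=
  forall M : finModel sg, set (k.-tuple M) -> Prop.

Definition isomorphism sg (M N : finModel sg) (h : M -> N) : Prop :=
  [/\ bijective h,
      forall (f : fsym sg) (a : (farity f).-tuple M),
        h (finterp a) = finterp (map_tuple h a) &
      forall (r : rsym sg) (a : (rarity r).-tuple M),
        rinterp a <-> rinterp (map_tuple h a)].

Definition closed_under_iso sg k (C : team_property sg k) : Prop :=
  forall (M N : finModel sg) (h : M -> N), isomorphism h ->
  forall (R : set (k.-tuple M)) (R' : set (k.-tuple N)),
    (forall a, R a <-> R' (map_tuple h a)) -> C M R -> C N R'.

(* All k-tuples over the list e, in lexicographic order. *)
Fixpoint lex_tuples T (e : seq T) (k : nat) : seq (k.-tuple T) :=
  match k with
  | 0 => [:: [tuple]]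
  | k'.+1 => [seq cons_tuple x a | x <- e, a <- lex_tuples e k']
  end.

Definition table T (e : seq T) k (R : set (k.-tuple T)) : seq bool :=
  [seq `[< R a >] | a <- lex_tuples e k].

(* The graph of f as a relation, the value being the first component. *)
Definition graph sg (M : finModel sg) (f : fsym sg) :
    set ((farity f).+1.-tuple M) :=
  [set a | thead a = finterp (behead_tuple a)].

(* The usual binary encoding of a finite structure whose domain is listed,
   without repetition, by e: the size of the domain in unary, then the characteristic
   strings of all relations (functions being given by their graphs). *)
Definition encode sg k (M : finModel sg) (R : set (k.-tuple M)) (e : seq M) :
    seq bool :=
  nseq #|M| true ++ false ::
  flatten [seq table e (@rinterp sg M r) | r <- enum (rsym sg)] ++
  flatten [seq table e (@graph sg M f) | f <- enum (fsym sg)] ++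
  table e R.

(* Every enumeration of the domain gives rise to a code of (M, R). *)
Definition language sg k (C : team_property sg k) : set (seq bool) :=
  [set w | exists (M : finModel sg) (R : set (k.-tuple M)) (e : seq M),
    [/\ uniq e, e =i predT, C M R & w = encode R e]].

(* Main.v *)
(** A machine deciding the class in time below n^d is described, as in Fagin's
theorem, by a universal formula over guessed functions: there are F with all
instances of a quantifier-free formula true, where times and tape cells are
d-tuples of elements, read as numbers in base n for a guessed linear order. All
constraints except those on the order are Horn-like and only force true facts to
hold; they need not say that the guessed tables are functional, because any run
extracted from them is a genuine run and must stop within the time bound.

Such a second order formula is turned into independence logic by quantifying
universally over the arguments and existentially over the values of the F's.
Dependence atoms make the value of each term a function of its arguments, and the
independence atom z _|_ c0 c1, where z is x if c0 = c1 and F says that x is in R,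
and the value of v otherwise, forces what F says is in R to occur as a value of
v. *)

(* The atom [z _|_ c0 c1] works because [c0] and [c1] are universally quantified over a domain with
   at least two elements. A tuple that F puts in R is the value of [z] in a row with [c0 = c1];
   independence repeats this value in a row with [c0 <> c1], where [z] is the value of [v]. The
   other inclusion is a first order condition on single rows, since the universal variables run
   through all tuples beside each value of [v].

   Acceptance is not expressed by an accepting time. Instead, each nonaccepting configuration in the
   tables must have a transition. If no accepting state were met, the tables would yield a run
   longer than the time bound; this uses that the bound holds on every branch, as it is not known
   which branch the tables follow.

   The guessed order selects one code of the structure as input. Closure under isomorphism makes the
   verdict independent of this choice. *)
From HB Require Import structures.
Require Import Defs.
From mathcomp Require Import all_boot ssralg poly zify.
From mathcomp Require Import boolp classical_sets.

Set Implicit Arguments.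
Unset Strict Implicit.
Unset Printing Implicit Defensive.

Local Open Scope classical_set_scope.

(** * Quantifier-free formulas and flatness *)

Section QF.
Variable sg : signature.

(** Atoms have no nested terms: [W] will contain applications of guessed functions to variables, and
    each such application becomes a single variable of the team. *)
Inductive qf (W : Type) : Type :=
| QTrue
| QEq of W & W
| QRel (r : rsym sg) of ('I_(rarity r) -> W)
| QFun (f : Defs.fsym sg) of ('I_(farity f) -> W) & W
| QNot of qf W
| QAnd of qf W & qf W.

Arguments QTrue {W}.

Fixpoint qmap W W' (h : W -> W') (q : qf W) : qf W' :=
  match q with
  | QTrue => QTrue
  | QEq w w' => QEq (h w) (h w')
  | QRel r ts => QRel (fun i => h (ts i))
  | QFun f ts w => QFun (fun i => h (ts i)) (h w)
  | QNot q => QNot (qmap h q)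
  | QAnd q1 q2 => QAnd (qmap h q1) (qmap h q2)
  end.

Section Derived.
Variable W : Type.
Implicit Types q : qf W.

Definition QImp q1 q2 := QNot (QAnd q1 (QNot q2)).
Definition QOr q1 q2 := QNot (QAnd (QNot q1) (QNot q2)).
Definition QBig I (s : seq I) (q : I -> qf W) := foldr (fun i => QAnd (q i)) QTrue s.
Definition QEx I (s : seq I) (q : I -> qf W) := QNot (QBig s (fun i => QNot (q i))).
End Derived.

Section Holds.
Variable M : finModel sg.

Fixpoint holds W (rho : W -> M) (q : qf W) : bool :=
  match q with
  | QTrue => true
  | QEq w w' => rho w == rho w'
  | QRel r ts => `[< rinterp [tuple rho (ts i) | i < rarity r] >]
  | QFun f ts w => finterp [tuple rho (ts i) | i < farity f] == rho w
  | QNot q => ~~ holds rho q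
  | QAnd q1 q2 => holds rho q1 && holds rho q2
  end.

Lemma holds_map W W' (h : W -> W') (rho : W' -> M) q :
  holds rho (qmap h q) = holds (rho \o h) q.
Proof. by elim: q => //= [q ->|q1 -> q2 ->]. Qed.

Lemma holds_and W (rho : W -> M) q1 q2 :
  holds rho (QAnd q1 q2) = holds rho q1 && holds rho q2.
Proof. by []. Qed.

Lemma holds_imp W (rho : W -> M) q1 q2 :
  holds rho (QImp q1 q2) = (holds rho q1 ==> holds rho q2).
Proof. by rewrite /= negb_and negbK implybE. Qed.

Lemma holds_or W (rho : W -> M) q1 q2 :
  holds rho (QOr q1 q2) = holds rho q1 || holds rho q2.
Proof. by rewrite /= negb_and !negbK. Qed.

Lemma holds_big W (rho : W -> M) I (s : seq I) q :
  holds rho (QBig s q) = all (fun i => holds rho (q i)) s.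
Proof. by elim: s => //= i s ->. Qed.

Lemma holds_ex W (rho : W -> M) I (s : seq I) q :
  holds rho (QEx s q) = has (fun i => holds rho (q i)) s.
Proof. by rewrite /= holds_big -has_predC /=; apply: eq_has => i /=; rewrite negbK. Qed.

Lemma eq_holds W (rho rho' : W -> M) q : rho =1 rho' -> holds rho q = holds rho' q.
Proof. by move=> /funext ->. Qed.

End Holds.

Section Flat.
(** [x0] serves to write truth as [x0 = x0]. *)
Variables (W : Type) (name : W -> nat) (x0 : nat).

(* The negation normal form of q (b = true) or of its negation (b = false). *)
Fixpoint tr (b : bool) (q : qf W) : formula sg :=
  let lit a := if b then Pos a else Neg a in
  match q with
  | QTrue => lit (AEq (Var sg x0) (Var sg x0))
  | QEq w w' => lit (AEq (Var sg (name w)) (Var sg (name w')))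
  | QRel r ts => lit (ARel (fun i => Var sg (name (ts i))))
  | QFun f ts w => lit (AEq (App (fun i => Var sg (name (ts i)))) (Var sg (name w)))
  | QNot q => tr (~~ b) q
  | QAnd q1 q2 => (if b then @And sg else @Or sg) (tr b q1) (tr b q2)
  end.

Lemma tr_fv b q : formula_fv (tr b q) `<=` x0 |` range name.
Proof.
elim: q b => //=.
- by case=> x /= [] ->; left.
- by move=> w w' []; move=> x /= [] ->; right; [exists w|exists w'|exists w|exists w'].
- by move=> r ts []; move=> x /= [i _ ->]; right; exists (ts i).
- by move=> f ts w []; move=> x /= [[i _ ->]|->]; right;
    [exists (ts i)|exists w|exists (ts i)|exists w].
- by move=> q1 IH1 q2 IH2 []; move=> x /= [/IH1|/IH2].
Qed.

Variable M : finModel sg.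

Lemma opt_tuple_Some n (g : 'I_n -> option M) (h : 'I_n -> M) :
  (forall i, g i = Some (h i)) -> opt_tuple g = Some [tuple h i | i < n].
Proof.
move=> gh; rewrite /opt_tuple.
have -> : pmap g (enum 'I_n) = map_tuple h (ord_tuple n).
  by rewrite (eq_pmap gh) /=; elim: (enum 'I_n) => //= i s ->.
by rewrite valK.
Qed.

(** Flatness: first order formulas are evaluated row by row, where [rho] gives the values of a row
    on [W]. *)
Lemma sat_tr (rho : assignment M -> W -> M) X b q :
  (forall s w, X s -> s (name w) = Some (rho s w)) ->
  sat X (tr b q) <-> (forall s, X s -> holds (rho s) q = b).
Proof.
have lit a (Y : set (assignment M)) (h : assignment M -> bool) c :
    (forall s, Y s -> atom_true s a <-> h s) ->
    sat Y (if c then Pos a else Neg a) <-> (forall s, Y s -> h s = c).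
  move=> ah; case: c => /=.
    by split=> H s Ys; [apply/ah/H|apply/ah=> //; rewrite H].
  split=> H s Ys; first by apply/negbTE/negP => hs; apply: (H s Ys); apply/ah.
  by rewrite ah // H.
elim: q b X => [|w w'|r ts|f ts w|q IH|q1 IH1 q2 IH2] b X Xrho.
- exact: lit.
- apply: lit => s Xs /=; rewrite !Xrho //.
  by split=> [[->]|/eqP ->].
- apply: (lit _ _ (fun s => holds (rho s) (QRel ts))) => s Xs /=.
  rewrite (opt_tuple_Some (h := fun i => rho s (ts i))); last by move=> i; rewrite Xrho.
  split=> [[d dr [E]]|/asboolP]; first by apply/asboolP; rewrite E.
  by exists [tuple rho s (ts i) | i < rarity r].
- apply: (lit _ _ (fun s => holds (rho s) (QFun ts w))) => s Xs /=.
  rewrite (opt_tuple_Some (h := fun i => rho s (ts i))); last by move=> i; rewrite Xrho.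
  by rewrite /= Xrho //; split=> [[->]|/eqP ->].
- rewrite /= IH //; split=> H s Xs; first by rewrite H // negbK.
  by rewrite -(H s Xs) negbK.
- case: b => /=.
    rewrite IH1 // IH2 //; split=> [[H1 H2] s Xs|H]; first by rewrite H1 // H2.
    by split=> s Xs; have /andP[] := H s Xs.
  split.
    case=> Y [Z [XE /IH1 HY /IH2 HZ]] s; rewrite XE => -[Ys|Zs].
    + by rewrite HY // => s' w Ys'; apply: Xrho; rewrite XE; left.
    + by rewrite HZ ?andbF // => s' w Ys'; apply: Xrho; rewrite XE; right.
  (* A negated conjunction is a disjunction: the team is split according to the conjunct that fails,
     with overlap allowed. *)
  move=> H; exists (X `&` [set s | holds (rho s) q1 = false]).
  exists (X `&` [set s | holds (rho s) q2 = false]); split.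
  + apply/seteqP; split=> s; last by case=> -[].
    move=> Xs; have /negbT := H s Xs; rewrite negb_and => /orP[/negbTE h|/negbTE h].
      by left.
    by right.
  + by apply/IH1 => [s w [Xs _]|s []//]; apply: Xrho.
  + by apply/IH2 => [s w [Xs _]|s []//]; apply: Xrho.
Qed.

End Flat.
End QF.

(** * Quantifier prefixes over teams *)

Section Prefix.
Variables (sg : signature) (M : finModel sg).
Implicit Types (s : assignment M) (X : set (assignment M)) (vs : seq nat).

Definition Alls vs (phi : formula sg) := foldr (@All sg) phi vs.
Definition Exs vs (phi : formula sg) := foldr (@Ex sg) phi vs.

Lemma Alls_fv vs phi : formula_fv (Alls vs phi) = formula_fv phi `\` [set` vs].
Proof.
elim: vs => [|x vs /= ->]; apply/seteqP; split=> y //=; first by case.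
  by move=> [[yphi yvs] yx]; split=> //; rewrite inE => /orP[/eqP|].
by move=> [yphi]; rewrite inE => /negP; rewrite negb_or => /andP[/eqP yx /negP].
Qed.

Lemma Exs_fv vs phi : formula_fv (Exs vs phi) = formula_fv phi `\` [set` vs].
Proof. by rewrite -Alls_fv; elim: vs => //= x vs ->. Qed.

(** Effect of a whole block of quantifiers at once: [s'] arises from [s] by updating the variables
    in [vs] one after another, in any order. *)
Definition varies vs s s' :=
  (forall y, y \notin vs -> s' y = s y) /\ (forall y, y \in vs -> s' y <> None).

Lemma varies_cons x vs s s' :
  varies (x :: vs) s s' <-> exists m, varies vs (update s x m) s'.
Proof.
split=> [[H1 H2]|[m [H1 H2]]].
  case E: (s' x) => [m|]; last by have := H2 x (mem_head _ _); rewrite E.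
  exists m; split=> y yvs; last by apply: H2; rewrite inE yvs orbT.
  rewrite /update; case: eqVneq => [->//|yx]; apply: H1.
  by rewrite inE negb_or yx.
split=> y; rewrite inE.
  by rewrite negb_or => /andP[/negbTE yx /H1 ->]; rewrite /update yx.
case/orP=> [/eqP ->|/H2 //]; case: (boolP (x \in vs)) => [/H2 //|/H1 ->].
by rewrite /update eqxx.
Qed.

Lemma sat_Alls vs X phi :
  sat X (Alls vs phi) <-> sat [set s' | exists2 s, X s & varies vs s s'] phi.
Proof.
elim: vs X => [|x vs IH] X /=.
  suff -> : [set s' | exists2 s, X s & varies [::] s s'] = X by [].
  apply/seteqP; split=> [s' [s Xs [H _]]|s Xs]; last by exists s.
  by have -> : s' = s by apply/funext => y; apply: H.
rewrite IH; set A := (X in sat X phi <-> _); set B := (X in _ <-> sat X phi).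
suff -> : A = B by [].
apply/seteqP; split=> s' /=.
  by case=> _ [s [m [Xs ->]]] vss'; exists s => //; apply/varies_cons; exists m.
case=> s Xs /varies_cons[m vss']; exists (update s x m) => //.
by exists s, m.
Qed.

(** Choice functions are set-valued, so a block of them amounts to a team [Y] of variants of rows of
    [X] that reaches every row of [X]. *)
Lemma sat_Exs vs X phi :
  sat X (Exs vs phi) <-> exists Y, [/\ forall s, X s -> exists2 s', Y s' & varies vs s s',
    forall s', Y s' -> exists2 s, X s & varies vs s s' & sat Y phi].
Proof.
elim: vs X => [|x vs IH] X /=.
  split=> [satX|[Y [XY YX satY]]].
    by exists X; split=> // s Xs; exists s.
  suff -> : X = Y by [].
  have eqv s s' : varies [::] s s' -> s' = s by case=> H _; apply/funext => y; apply: H.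
  by apply/seteqP; split=> s; [case/XY => s' Ys' /eqv <-|case/YX => s' Ys' /eqv ->].
split.
  case=> H H0 /IH[Y [XY YX satY]]; exists Y; split=> //.
    move=> s Xs; have [m Hm] := H0 s Xs.
    have [|s' Ys' vs'] := XY (update s x m); first by exists s, m.
    by exists s' => //; apply/varies_cons; exists m.
  move=> s' /YX[_ [s [m [Xs _ ->]]] vss']; exists s => //.
  by apply/varies_cons; exists m.
case=> Y [XY YX satY].
(* All values from which [Y] can still be reached are chosen together; this is where lax semantics
   is used. *)
exists (fun s m => exists2 s', Y s' & varies vs (update s x m) s').
  by move=> s /XY[s' Ys' /varies_cons[m vss']]; exists m; exists s'.
apply/IH; exists Y; split=> //.
  by move=> _ [s [m [Xs [s' Ys' vss'] ->]]]; exists s'.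
move=> s' Ys'; have [s Xs /varies_cons[m vss']] := YX s' Ys'.
by exists (update s x m) => //; exists s, m; split=> //; exists s'.
Qed.

End Prefix.

(** * Assignments overwritten on a finite family of variables *)

Section Overwrite.
Variables (J : finType) (nm : J -> nat) (D : Type).
Hypothesis nm_inj : injective nm.
Implicit Types s : assignment D.

Definition names := [seq nm j | j <- enum J].

Lemma mem_names j : nm j \in names.
Proof. by rewrite map_f // mem_enum. Qed.

Definition overwrite s (f : J -> D) : assignment D :=
  fun y => if [pick j | nm j == y] is Some j then Some (f j) else s y.

Lemma overwrite_nm s f j : overwrite s f (nm j) = Some (f j).
Proof.
rewrite /overwrite; case: pickP => [j' /eqP/nm_inj -> //|/(_ j)].
by rewrite eqxx.
Qed.

Lemma overwrite_other s f y : y \notin names -> overwrite s f y = s y.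
Proof.
by rewrite /overwrite; case: pickP => // j /eqP <-; rewrite mem_names.
Qed.

End Overwrite.

Lemma varies_overwrite (J : finType) (nm : J -> nat) sg (M : finModel sg)
    (s : assignment M) (f : J -> M) :
  injective nm -> varies (names nm) s (overwrite nm s f).
Proof.
move=> nm_inj; split=> y; first exact: overwrite_other.
by case/mapP=> j _ ->; rewrite overwrite_nm.
Qed.

(** * Formulas with one universal and one existential block *)

Section TeamPrefix.
Variables (sg : signature) (Ku Ke : finType) (k : nat) (v : k.-tuple nat) (u0 : Ku).

Definition key := (Ku + Ke + 'I_k)%type.

(** Quantified variables are numbered beyond the largest entry of [v], so that no quantifier
    overwrites the team variables. *)
Definition key_name (w : key) : nat :=
  match w with
  | inl j => (\max_(x <- v) x).+1 + enum_rank j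
  | inr i => tnth v i
  end.

Definition uname u := key_name (inl (inl u)).
Definition ename e := key_name (inl (inr e)).

Lemma key_name_inj : injective (key_name \o inl).
Proof. by move=> j j' /= /addnI/val_inj/enum_rank_inj. Qed.

Lemma uname_inj : injective uname.
Proof. by move=> u u' /key_name_inj[]. Qed.

Lemma ename_inj : injective ename.
Proof. by move=> u u' /key_name_inj[]. Qed.

Lemma uname_ename u : uname u \notin names ename.
Proof. by apply/mapP => -[e _ /key_name_inj]. Qed.

Lemma key_name_v j i : key_name (inl j) <> tnth v i.
Proof.
move=> E; have : tnth v i <= \max_(x <- v) x.
  by apply: (leq_bigmax_seq (P := xpredT) (F := id)); rewrite ?mem_tnth.
by rewrite -E /= addSn ltnNge leq_addr.
Qed.

Lemma v_uname i : tnth v i \notin names uname.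
Proof. by apply/mapP => -[u _ /esym/key_name_v]. Qed.

Lemma v_ename i : tnth v i \notin names ename.
Proof. by apply/mapP => -[u _ /esym/key_name_v]. Qed.

Definition key_var (w : key) := Var sg (key_name w).

(** The triple follows the argument order of [Indep]: its middle component is the tuple conditioned
    on. *)
Definition indep_formula (t : seq key * seq key * seq key) :=
  Indep (map key_var t.1.1) (map key_var t.1.2) (map key_var t.2).

Definition matrix (psi : qf sg key) (ts : seq (seq key * seq key * seq key)) :=
  And (tr key_name (uname u0) true psi)
      (foldr (fun t => And (indep_formula t))
             (Pos (AEq (Var sg (uname u0)) (Var sg (uname u0)))) ts).

Definition prefixed psi ts :=
  Alls (names uname) (Exs (names ename) (matrix psi ts)).

Lemma terms_fv_key t : terms_fv (map key_var t) `<=` range key_name.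
Proof.
by elim: t => //= w t IH x /= [->|/IH //]; exists w.
Qed.

Lemma prefixed_fv psi ts : formula_fv (prefixed psi ts) `<=` [set x | x \in v].
Proof.
rewrite Alls_fv Exs_fv => x [[mx xe] xu] /=.
suff [w _ xw] : range key_name x.
  rewrite -xw; case: w xw => [[u|e]|i] xw; last exact: mem_tnth.
    by case: xu; rewrite /= -xw; apply: mem_names.
  by case: xe; rewrite /= -xw; apply: mem_names.
case: mx => [/tr_fv[->|//]|]; first by exists (inl (inl u0)).
elim: ts => [[] ->|t ts IH [[[]|]|/IH//]]; try by exists (inl (inl u0)).
- exact: terms_fv_key.
- exact: terms_fv_key.
- exact: terms_fv_key.
Qed.

Variable M : finModel sg.
Implicit Types (s : assignment M) (X Y : set (assignment M)) (T : set (key -> M)).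

Definition indep_on T (t : seq key * seq key * seq key) :=
  forall rho rho', T rho -> T rho' -> map rho t.1.2 = map rho' t.1.2 ->
  exists rho'', [/\ T rho'',
    map rho'' (t.1.2 ++ t.1.1) = map rho (t.1.2 ++ t.1.1) &
    map rho'' (t.1.2 ++ t.2) = map rho' (t.1.2 ++ t.2)].

Definition val_at s (rho : key -> M) := forall w, s (key_name w) = Some (rho w).

Lemma val_at_map s rho t : val_at s rho ->
  map (eval s) (map key_var t) = map (@Some M) (map rho t).
Proof. by move=> sr; rewrite -!map_comp; apply: eq_map => w /=; apply: sr. Qed.

(** Rows may differ outside the keys, which the formula cannot see; so it suffices that [Y] and [T]
    cover each other. *)
Lemma sat_matrix Y T psi ts :
  (forall s, Y s -> exists2 rho, T rho & val_at s rho) ->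
  (forall rho, T rho -> exists2 s, Y s & val_at s rho) ->
  sat Y (matrix psi ts) <->
  (forall rho, T rho -> holds rho psi) /\ (forall t, t \in ts -> indep_on T t).
Proof.
move=> YT TY; have inj t t' : map (@Some M) t = map (@Some M) t' -> t = t'.
  by apply: inj_map => m m' [].
have /card_gt0P[m0 _] := ltnW (dom_gt1 M).
pose rho s w := odflt m0 (s (key_name w)).
have rhoE s r : val_at s r -> rho s = r.
  by move=> sr; apply/funext => w; rewrite /rho sr.
have Yrho s w : Y s -> s (key_name w) = Some (rho s w).
  by move=> /YT[r _ sr]; rewrite (rhoE _ _ sr) sr.
have flat : sat Y (tr key_name (uname u0) true psi) <->
    (forall r, T r -> holds r psi).
  rewrite (sat_tr (rho := rho) _) //; split.
    by move=> H r /TY[s Ys /rhoE <-]; apply: H.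
  by move=> H s /YT[r Tr /rhoE ->]; apply: H.
have indep t : sat Y (indep_formula t) <-> indep_on T t.
  split=> H.
    move=> r r' /TY[s Ys sr] /TY[s' Ys' sr'] rr'.
    have [|s'' [Ys'']] := H s s' Ys Ys'.
      by rewrite (val_at_map _ sr) (val_at_map _ sr') rr'.
    have [r'' Tr'' sr''] := YT _ Ys''.
    rewrite -!map_cat !(val_at_map _ sr) !(val_at_map _ sr') !(val_at_map _ sr'').
    by move=> /inj E /inj E'; exists r''.
  move=> s s' /YT[r Tr sr] /YT[r' Tr' sr'].
  rewrite (val_at_map _ sr) (val_at_map _ sr') => /inj rr'.
  have [r'' [/TY[s'' Ys'' sr''] E E']] := H r r' Tr Tr' rr'.
  exists s''; split=> //; rewrite -!map_cat.
    by rewrite (val_at_map _ sr) (val_at_map _ sr'') E.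
  by rewrite (val_at_map _ sr') (val_at_map _ sr'') E'.
rewrite /matrix /= flat; split=> -[H1 H2]; split=> // {flat H1}.
  move: H2; elim: ts => //= t ts IH [/indep Ht /IH Hts] t'.
  by rewrite inE => /orP[/eqP -> //|/Hts].
elim: ts H2 => //= t ts IH H; split; first by apply/indep/H/mem_head.
by apply: IH => t' t's; apply: H; rewrite inE t's orbT.
Qed.

(** The team enters only through [team_rel v X]. As the universal variables take all values on every
    row, each tuple of this relation is combined with each [al]. *)
Lemma sat_prefixed (V : set nat) X psi ts :
  team_on V X -> [set x | x \in v] `<=` V ->
  sat X (prefixed psi ts) <-> exists T, [/\
    forall r (al : Ku -> M), team_rel v X r -> exists rho, [/\ T rho,
      forall u, rho (inl (inl u)) = al u & forall i, rho (inr i) = tnth r i],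
    forall rho, T rho -> team_rel v X [tuple rho (inr i) | i < k],
    forall rho, T rho -> holds rho psi &
    forall t, t \in ts -> indep_on T t].
Proof.
move=> XV vV; have /card_gt0P[m0 _] := ltnW (dom_gt1 M).
have Xv s i : X s -> exists m, s (tnth v i) = Some m.
  move=> Xs; case E: (s (tnth v i)) => [m|]; first by exists m.
  by have /XV/(_ (tnth v i)) := Xs; case=> _ /(_ (vV _ (mem_tnth _ _))); rewrite E.
pose rho s w := odflt m0 (s (key_name w)).
have rhoE s r : val_at s r -> rho s = r.
  by move=> sr; apply/funext => w; rewrite /rho sr.
rewrite /prefixed sat_Alls sat_Exs; split.
  case=> Y [XY YX satY]; exists (rho @` Y).
  have valY s' : Y s' -> val_at s' (rho s').
    move=> /[dup] Ys' /YX[s1 [s Xs [ss1 ss1u]] [s1s' s1s'e]] w.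
    suff : s' (key_name w) <> None by rewrite /rho; case: (s' _).
    case: w => [[u|e]|i].
    - rewrite s1s' ?(uname_ename u) //; apply: ss1u; exact: mem_names.
    - by apply: s1s'e; apply: mem_names.
    - by rewrite s1s' ?v_ename // ss1 ?v_uname //; have [m ->] := Xv s i Xs.
  have satY' := (@sat_matrix Y (rho @` Y) psi ts).
  move: satY' => [||/(_ satY)[H1 H2] _].
  - by move=> s Ys; exists (rho s); [exists s|apply: valY].
  - by move=> _ [s Ys <-]; exists s; last apply: valY.
  split=> //.
  + move=> r al [s Xs sr].
    have [|s' Ys' [s's1 _]] := XY (overwrite uname s al).
      by exists s => //; apply: varies_overwrite uname_inj.
    exists (rho s'); split; first by exists s'.
      by move=> u; rewrite /rho s's1 ?uname_ename // overwrite_nm //; apply: uname_inj.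
    move=> i; rewrite /rho s's1 ?v_ename // overwrite_other ?v_uname //.
    by rewrite sr.
  + move=> _ [s' Ys' <-]; have [s1 [s Xs [ss1 _]] [s1s' _]] := YX _ Ys'.
    exists s => // i; rewrite tnth_mktuple -(valY s') //=.
    by rewrite s1s' ?v_ename // ss1 ?v_uname.
case=> T [cov TR Tpsi Tts].
set X1 := [set s' | _].
(* All existential variants that realise a valuation in [T]; rows of [X] with the same values on [v]
   each get their own. *)
exists [set s' | exists s1 r, [/\ X1 s1, T r, val_at s' r & varies (names ename) s1 s']].
split.
- move=> s1 [s Xs [ss1 ss1u]].
  pose r : k.-tuple M := [tuple odflt m0 (s (tnth v i)) | i < k].
  have sr i : s (tnth v i) = Some (tnth r i).
    by rewrite tnth_mktuple; have [m ->] := Xv s i Xs.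
  have [|r' [Tr' r'u r'v]] := cov r (fun u => odflt m0 (s1 (uname u))).
    by exists s.
  exists (overwrite ename s1 (fun e => r' (inl (inr e)))); last first.
    exact: varies_overwrite ename_inj.
  exists s1, r'; split=> //; [by exists s| |exact: varies_overwrite ename_inj].
  case=> [[u|e]|i].
  + rewrite overwrite_other ?(uname_ename u) // r'u -/(uname u).
    by case E: (s1 _) => //; have := ss1u _ (mem_names uname u); rewrite E.
  + by rewrite -/(ename e) (overwrite_nm ename_inj).
  + by rewrite overwrite_other ?v_ename // ss1 ?v_uname //= sr r'v.
- by move=> s' [s1 [r [? ? ? ?]]]; exists s1.
apply/(sat_matrix (T := T)); last by split.
- by move=> s' [s1 [r [? ? ? ?]]]; exists r.
move=> r Tr; have [s Xs sr] := TR r Tr.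
pose s1 := overwrite uname s (fun u => r (inl (inl u))).
exists (overwrite ename s1 (fun e => r (inl (inr e)))).
  exists s1, r; split=> //; [| |exact: varies_overwrite ename_inj].
    by exists s => //; apply: varies_overwrite uname_inj.
  case=> [[u|e]|i].
  + by rewrite overwrite_other ?(uname_ename u) // -/(uname u) /s1 (overwrite_nm uname_inj).
  + by rewrite -/(ename e) (overwrite_nm ename_inj).
  + by rewrite overwrite_other ?v_ename // /s1 overwrite_other ?v_uname //= sr tnth_mktuple.
case=> [[u|e]|i].
+ by rewrite overwrite_other ?(uname_ename u) // -/(uname u) /s1 (overwrite_nm uname_inj).
+ by rewrite -/(ename e) (overwrite_nm ename_inj).
+ by rewrite overwrite_other ?v_ename // /s1 overwrite_other ?v_uname //= sr tnth_mktuple.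
Qed.

End TeamPrefix.

(** * Skolem normal forms in independence logic *)

Section SkolemForm.
Variables (sg : signature) (U G : finType) (A k : nat) (gR g0 : G) (v : k.-tuple nat).
Hypothesis kA : k <= A.

(* [inr (g, s)] stands for the value of the guessed function g at the variables s. *)
Definition wvar := (U + G * A.-bseq U)%type.
(* Besides the variables in U there are canonical arguments 'I_A and the two
   elements c0, c1 of the independence atom. Occurrences g(s) and g(s') of the same
   function with overlapping variables cannot be compared directly, as no row has
   both s and s' equal to a given tuple; each is compared with g at the canonical
   arguments instead, which are independent of U. *)
Definition uvar := (U + 'I_A + bool)%type.
(** The component ['I_k] holds the variables [z] of the independence atom. *)
Definition evar := (G * A.-bseq uvar + 'I_k)%type.
Local Notation key := (key uvar evar k).

Definition wcan q : A.-bseq uvar :=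
  insub_bseq A [seq inl (inr i) | i <- take q (enum 'I_A)].

Definition ukey (u : uvar) : key := inl (inl u).
Definition okey (g : G) (s : A.-bseq uvar) : key := inl (inr (inl (g, s))).
Definition zkey (i : 'I_k) : key := inl (inr (inr i)).
Definition vkey (i : 'I_k) : key := inr i.
Definition wkey i : key := ukey (inl (inr (widen_ord kA i))).

Definition wkey_of (x : wvar) : key :=
  match x with
  | inl u => ukey (inl (inl u))
  | inr (g, s) => okey g (map_bseq (fun u => inl (inl u)) s)
  end.

Definition QEqs W (s t : seq W) : qf sg W := QBig (zip s t) (fun p => QEq sg p.1 p.2).

Definition Qconsistent : qf sg key :=
  QBig (enum {: G * A.-bseq uvar}) (fun o =>
    QImp (QEqs (map ukey o.2) (map ukey (wcan (size o.2))))
         (QEq sg (okey o.1 o.2) (okey o.1 (wcan (size o.2))))).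

Definition QinR : qf sg key := QEq sg (okey gR (wcan k)) (okey g0 (wcan 0)).

Definition QflagR : qf sg key :=
  QAnd (QEq sg (ukey (inr true)) (ukey (inr false))) QinR.

(** The implication with conclusion [QinR] puts the team relation inside the guessed one. The last
    two conjuncts define [z] by cases for the independence atom, which gives the reverse
    inclusion. *)
Definition Qskolem (psi : qf sg wvar) : qf sg key :=
  QAnd (qmap wkey_of psi) (QAnd Qconsistent
  (QAnd (QImp (QBig (enum 'I_k) (fun i => QEq sg (wkey i) (vkey i))) QinR)
  (QAnd (QImp QflagR (QBig (enum 'I_k) (fun i => QEq sg (zkey i) (wkey i))))
        (QOr QflagR (QBig (enum 'I_k) (fun i => QEq sg (zkey i) (vkey i))))))).

(** Independence of [x] from itself given [s] is the dependence atom that makes [x] a function of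
    [s]. *)
Definition skolem_indeps : seq (seq key * seq key * seq key) :=
  (map zkey (enum 'I_k), [::], [:: ukey (inr true); ukey (inr false)]) ::
  [seq ([:: okey o.1 o.2], map ukey o.2, [:: okey o.1 o.2])
  | o : G * A.-bseq uvar].

Definition skolem_formula psi : formula sg :=
  prefixed v (inr true : uvar) (Qskolem psi) skolem_indeps.

Variable M : finModel sg.

Definition wval (F : G -> seq M -> M) (env : U -> M) (x : wvar) : M :=
  match x with
  | inl u => env u
  | inr (g, s) => F g (map env s)
  end.

Lemma holds_eqs W (rho : W -> M) s t : size s = size t ->
  holds rho (QEqs s t) = (map rho s == map rho t).
Proof.
rewrite /QEqs holds_big; elim: s t => [|x s IH] [|y t] //= [/IH ->].
by rewrite eqseq_cons.
Qed.

Lemma holds_eq_fam (rho : key -> M) (f g : 'I_k -> key) :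
  holds rho (QBig (enum 'I_k) (fun i => QEq sg (f i) (g i))) <->
  (forall i, rho (f i) = rho (g i)).
Proof.
rewrite holds_big; split=> [/allP H i|H]; first by apply/eqP/H; rewrite mem_enum.
by apply/allP => i _; apply/eqP/H.
Qed.

Lemma holds_skolem (rho : key -> M) psi : holds rho (Qskolem psi) <->
  [/\ holds (rho \o wkey_of) psi, holds rho Qconsistent,
      (forall i, rho (wkey i) = rho (vkey i)) -> holds rho QinR,
      holds rho QflagR -> forall i, rho (zkey i) = rho (wkey i) &
      ~~ holds rho QflagR -> forall i, rho (zkey i) = rho (vkey i)].
Proof.
rewrite /Qskolem !holds_and holds_or !holds_imp -holds_map; split.
  case/and5P=> hpsi hcons /implyP wR /implyP zw /orP zv; split=> //.
  - by move=> /holds_eq_fam/wR.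
  - by move=> /zw/holds_eq_fam.
  - by move=> /negP nR; apply/holds_eq_fam; case: zv.
case=> [hpsi hcons wR zw zv]; apply/and5P; split=> //.
- by apply/implyP=> /holds_eq_fam.
- by apply/implyP=> /zw zw'; apply/holds_eq_fam.
- by rewrite -implyNb; apply/implyP => /zv zv'; apply/holds_eq_fam.
Qed.

Lemma wcanE q : wcan q = [seq inl (inr i) | i <- take q (enum 'I_A)] :> seq uvar.
Proof.
rewrite /wcan /insub_bseq val_insubd size_map size_take size_enum_ord.
by case: ltnP => [/ltnW ->|_]; rewrite ?leqnn.
Qed.

Lemma size_wcan q : q <= A -> size (wcan q) = q.
Proof.
move=> qA; rewrite wcanE size_map size_take size_enum_ord.
by case: ltngtP qA.
Qed.

Lemma map_wcan (al : uvar -> M) m0 l : size l <= A ->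
  (forall i : 'I_A, i < size l -> al (inl (inr i)) = nth m0 l i) ->
  map al (wcan (size l)) = l.
Proof.
move=> lA all; rewrite wcanE -map_comp.
have -> : map (al \o (inl \o inr)) (take (size l) (enum 'I_A)) =
    [seq nth m0 l (nat_of_ord i) | i <- take (size l) (enum 'I_A)].
  apply/eq_in_map => i il; apply: all.
  have : nat_of_ord i \in map (@nat_of_ord A) (take (size l) (enum 'I_A)).
    exact: map_f.
  by rewrite map_take val_enum_ord take_iota (minn_idPl lA) mem_iota.
rewrite (map_comp (nth m0 l) (@nat_of_ord A)) map_take val_enum_ord take_iota.
by rewrite (minn_idPl lA) map_nth_iota0 // take_size.
Qed.

(** The witness row shares its [x] with both given rows, so these agree on [x]. *)
Lemma indep_on_dep (T : set (key -> M)) x s : indep_on T ([:: x], s, [:: x]) <->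
  (forall rho rho', T rho -> T rho' -> map rho s = map rho' s -> rho x = rho' x).
Proof.
split=> H r r' Tr Tr' rr'.
  have [r'' [_ /= E E']] := H r r' Tr Tr' rr'.
  have last_eq (r1 r2 : key -> M) :
      map r1 (s ++ [:: x]) = map r2 (s ++ [:: x]) -> r1 x = r2 x.
    by rewrite !cats1 !map_rcons => /rcons_inj[].
  by rewrite -(last_eq _ _ E) (last_eq _ _ E').
by exists r; split=> //=; rewrite !map_cat rr' /= (H _ _ Tr Tr' rr').
Qed.

(** * Reading functions off a team *)

Section Sound.
Variables (psi : qf sg wvar) (R : set (k.-tuple M)) (T : set (key -> M)).
Hypothesis R0 : R !=set0.
Hypothesis cov : forall r (al : uvar -> M), R r -> exists rho, [/\ T rho,
  forall u, rho (ukey u) = al u & forall i, rho (vkey i) = tnth r i].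
Hypothesis TR : forall rho, T rho -> R [tuple rho (vkey i) | i < k].
Hypothesis Tpsi : forall rho, T rho -> holds rho (Qskolem psi).
Hypothesis Tindep : forall t, t \in skolem_indeps -> indep_on T t.

Lemma skolem_functions : exists F : G -> seq M -> M,
  (forall a, R a <-> F gR a = F g0 [::]) /\ forall env, holds (wval F env) psi.
Proof.
have /card_gt0P[m0 _] := ltnW (dom_gt1 M).
have dep g (s : A.-bseq uvar) rho rho' : T rho -> T rho' ->
    map (rho \o ukey) s = map (rho' \o ukey) s -> rho (okey g s) = rho' (okey g s).
  move=> Tr Tr' rr'; have : indep_on T ([:: okey g s], map ukey s, [:: okey g s]).
    by apply: Tindep; rewrite inE; apply/orP; right; apply/mapP; exists (g, s); rewrite ?mem_enum.
  by move/indep_on_dep; apply=> //; rewrite -!map_comp.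
(* The value of [g] at [l] is read in a row whose canonical arguments are [l]. Such a row exists by
   [cov], and dependence makes its choice immaterial; lists longer than [A] get some arbitrary
   value. *)
have [F1 F1P] : {F1 : G * seq M -> M & forall gl, size gl.2 <= A ->
    forall rho, T rho -> map (rho \o ukey) (wcan (size gl.2)) = gl.2 ->
    rho (okey gl.1 (wcan (size gl.2))) = F1 gl}.
  apply: (@choice _ _ (fun gl m => size gl.2 <= A ->
    forall rho, T rho -> map (rho \o ukey) (wcan (size gl.2)) = gl.2 ->
    rho (okey gl.1 (wcan (size gl.2))) = m)) => -[g l] /=.
  case: (R0) => r Rr.
  have [rho0 [Trho0 rho0u _]] := cov
    (fun u => if u is inl (inr i) then nth m0 l i else m0) Rr.
  exists (rho0 (okey g (wcan (size l)))) => lA rho Trho rhol; apply: dep => //.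
  by rewrite rhol (map_wcan (m0 := m0)) // => i _ /=; rewrite rho0u.
pose F g l := F1 (g, l); exists F.
have FP g l rho : size l <= A -> T rho ->
    map (rho \o ukey) (wcan (size l)) = l -> rho (okey g (wcan (size l))) = F g l.
  by move=> lA Trho rhol; apply: (F1P (g, l)).
(* To compare [g] at [s] with its canonical occurrence, pass to a row with the same values on [U]
   whose canonical arguments repeat those of [s]; consistency applies there. *)
have FU g (s : A.-bseq U) rho : T rho ->
    rho (okey g (map_bseq (fun u => inl (inl u)) s)) =
    F g (map (fun u => rho (ukey (inl (inl u)))) s).
  move=> Trho; set s' := map_bseq _ s; set l := map _ s.
  have ls' : l = map (rho \o ukey) s' by rewrite /= -map_comp.
  have lA : size l <= A by rewrite size_map size_bseq.
  have s's : size s' = size l by rewrite /= !size_map.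
  have [rho1 [Trho1 rho1u _]] := cov
    (fun u => if u is inl (inr i) then nth m0 l i else rho (ukey u)) (TR Trho).
  have s'1 : map (rho1 \o ukey) s' = l.
    by rewrite /= -map_comp; apply: eq_map => u /=; rewrite rho1u.
  have w1 : map (rho1 \o ukey) (wcan (size l)) = l.
    by rewrite (map_wcan (m0 := m0)) // => i _ /=; rewrite rho1u.
  rewrite (dep g s' rho rho1 Trho Trho1 (etrans (esym ls') (esym s'1))).
  rewrite -(FP g l rho1) //.
  have /holds_skolem[_ + _ _ _] := Tpsi Trho1.
  rewrite holds_big => /allP/(_ (g, s')); rewrite mem_enum => /(_ isT).
  rewrite holds_imp -[(g, s').1]/g -[(g, s').2]/s' s's.
  rewrite holds_eqs; last by rewrite [in LHS]size_map s's size_map size_wcan.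
  rewrite -!(map_comp rho1 ukey) s'1 w1 eqxx.
  by move=> /eqP.
have inR rho a : T rho -> (forall i, rho (wkey i) = tnth a i) ->
    holds rho QinR = (F gR a == F g0 [::]).
  move=> Trho rhoa; have sa := size_tuple a.
  have EA : map (rho \o ukey) (wcan k) = a.
    rewrite -[k in wcan k]sa (map_wcan (m0 := m0)) ?sa // => i ik.
    have -> : i = widen_ord kA (Ordinal ik) by apply: val_inj.
    by rewrite -[RHS](tnth_nth m0 a (Ordinal ik)) -rhoa.
  rewrite /= -(FP g0 [::] rho) //; last by rewrite /= wcanE take0.
  by rewrite -(FP gR a rho) ?sa.
(* The canonical arguments start with [a], and [b] decides whether [c0 = c1]. *)
have pad (a : k.-tuple M) b : {al : uvar -> M | [/\
    forall i, al (inl (inr (widen_ord kA i))) = tnth a i,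
    al (inr true) = m0 & al (inr false) = b]}.
  exists (fun u : uvar => match u with
    inl (inr i) => nth m0 a i | inr false => b | _ => m0 end).
  by split=> // i; rewrite (tnth_nth m0).
split.
  move=> a; have [al [alw alt alf]] := pad a m0; split=> [Ra|/eqP FRa].
    have [rho [Trho rhou rhov]] := cov al Ra.
    have rhow i : rho (wkey i) = tnth a i by rewrite /wkey rhou.
    have /holds_skolem[_ _ + _ _] := Tpsi Trho.
    by rewrite (inR _ _ Trho rhow) => FRa; apply/eqP/FRa => i; rewrite rhow rhov.
  (* Here [F] puts [a] in the relation. In [rho] we have [c0 = c1], so [z] is [a]; in [rho1] we have
     [c0 <> c1]. Independence yields [rho2] with [z] from [rho] and [c0], [c1] from [rho1]; there
     [z] is the value of [v]. *)
  case: (R0) => r Rr; have [rho [Trho rhou _]] := cov al Rr.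
  have rhow i : rho (wkey i) = tnth a i by rewrite /wkey rhou.
  have /holds_skolem[_ _ _ + _] := Tpsi Trho.
  rewrite /QflagR holds_and (inR _ _ Trho rhow) /= !rhou alt alf eqxx.
  move=> /(_ FRa) rhoz.
  have [m1 m1m0] : exists m1 : M, m1 != m0.
    have : 0 < #|predC1 m0| by rewrite cardC1 -subn1 subn_gt0 dom_gt1.
    by case/card_gt0P => m1; exists m1.
  have [al1 [_ al1t al1f]] := pad a m1; have [rho1 [Trho1 rho1u _]] := cov al1 Rr.
  have [//|rho2 [Trho2 Ez /= [E1 E2]]] :=
    Tindep (mem_head _ _) Trho Trho1.
  have /holds_skolem[_ _ _ _] := Tpsi Trho2.
  rewrite /QflagR /= E1 E2 !rho1u al1t al1f eq_sym (negbTE m1m0) => /(_ isT) z2.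
  suff -> : a = [tuple rho2 (vkey i) | i < k] by exact: TR.
  apply: eq_from_tnth => i; rewrite tnth_mktuple -z2 -rhow -rhoz.
  have : map (rho2 \o zkey) (enum 'I_k) = map (rho \o zkey) (enum 'I_k).
    by rewrite (map_comp rho2) (map_comp rho).
  move=> /eq_in_map/(_ i).
  by rewrite mem_enum /= => ->.
move=> env; case: (R0) => r Rr.
have [rho [Trho rhou _]] := cov (fun u => if u is inl (inl u) then env u else m0) Rr.
have /holds_skolem[+ _ _ _ _] := Tpsi Trho.
rewrite (@eq_holds _ _ _ _ (wval F env)) // => -[u|[g s]] /=; first by rewrite rhou.
by rewrite FU //; congr (F g _); apply: eq_map => u; rewrite rhou.
Qed.
End Sound.

(** * Building a team from functions *)

Section Complete.
Variables (psi : qf sg wvar) (R : set (k.-tuple M)) (F : G -> seq M -> M).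
Hypothesis FR : forall a : k.-tuple M, R a <-> F gR a = F g0 [::].
Hypothesis Fpsi : forall env, holds (wval F env) psi.

Definition skolem_row (al : uvar -> M) (r : k.-tuple M) (x : key) : M :=
  match x with
  | inl (inl u) => al u
  | inl (inr (inl (g, s))) => F g (map al s)
  | inl (inr (inr i)) =>
      if (al (inr true) == al (inr false)) && (F gR (map al (wcan k)) == F g0 [::])
      then al (inl (inr (widen_ord kA i))) else tnth r i
  | inr i => tnth r i
  end.

(** In every row the value of [z] lies in [R]: either [F] says so of the canonical tuple, or it is
    the team tuple. Hence it can be reused as team tuple next to any [c0], [c1]. *)
Lemma skolem_team : exists T : set (key -> M),
  [/\ forall r (al : uvar -> M), R r -> exists rho, [/\ T rho,
        forall u, rho (ukey u) = al u & forall i, rho (vkey i) = tnth r i],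
      forall rho, T rho -> R [tuple rho (vkey i) | i < k],
      forall rho, T rho -> holds rho (Qskolem psi) &
      forall t, t \in skolem_indeps -> indep_on T t].
Proof.
have /card_gt0P[m0 _] := ltnW (dom_gt1 M).
exists [set rho | exists al r, R r /\ rho = skolem_row al r].
have map_w (al : uvar -> M) :
    map al (wcan k) = [tuple al (inl (inr (widen_ord kA i))) | i < k].
  set t := mktuple _; have st := size_tuple t.
  rewrite -[k in wcan k]st (map_wcan (m0 := m0)) ?st // => i ik.
  rewrite -[RHS](tnth_nth m0 t (Ordinal ik)) tnth_mktuple; congr (al (inl (inr _))).
  exact: val_inj.
have flagE al r : holds (skolem_row al r) QflagR =
    (al (inr true) == al (inr false)) && (F gR (map al (wcan k)) == F g0 [::]).
  by rewrite /= (wcanE 0) take0.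
split.
- by move=> r al Rr; exists (skolem_row al r); split=> //; exists al, r.
- move=> _ [al [r [Rr ->]]]; congr (R _) : Rr.
  by apply: eq_from_tnth => i; rewrite tnth_mktuple.
- move=> _ [al [r [Rr ->]]]; apply/holds_skolem; split.
  + rewrite (@eq_holds _ _ _ _ (wval F (al \o inl \o inl))) // => -[u|[g s]] //=.
    by rewrite -map_comp.
  + rewrite holds_big; apply/allP => -[g s] _; rewrite holds_imp.
    rewrite holds_eqs ?size_map ?size_wcan ?size_bseq // -!map_comp.
    by apply/implyP => /eqP /= ->.
  + move=> wv; rewrite /= (wcanE 0) take0 map_w; apply/eqP/FR.
    congr (R _) : Rr; apply: eq_from_tnth => i; rewrite tnth_mktuple.
    exact/esym/wv.
  + by rewrite flagE => fl i /=; rewrite fl.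
  + by rewrite flagE => /negbTE fl i /=; rewrite fl.
- move=> t; rewrite inE => /orP[/eqP ->|/mapP[[g s] _ ->]]; last first.
    apply/indep_on_dep => _ _ [al [r [_ ->]]] [al' [r' [_ ->]]].
    by rewrite -!map_comp /= => ->.
  move=> _ _ [al [r [Rr ->]]] [al' [r' [Rr' ->]]] _ /=.
  pose a := [tuple skolem_row al r (zkey i) | i < k].
  have Ra : R a.
    case: (boolP (holds (skolem_row al r) QflagR)).
      rewrite flagE => fl; apply/FR; have /andP[_ /eqP <-] := fl; congr (F gR _).
      by rewrite map_w; apply/congr1/eq_from_tnth => i; rewrite !tnth_mktuple /= fl.
    rewrite flagE => /negbTE fl; congr (R _) : Rr.
    by apply: eq_from_tnth => i; rewrite tnth_mktuple /= fl.
  (* Once the team tuple and the canonical tuple are both [a], [z] is [a] whatever the flag is. *)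
  pose al2 u := match u with inl (inr i) => nth m0 a i | _ => al' u end.
  exists (skolem_row al2 a); split=> //; first by exists al2, a.
  rewrite -!map_comp; apply: eq_map => i.
  apply: (@etrans _ _ (tnth a i)).
    by rewrite /= [in RHS](tnth_nth m0) /=; case: ifP; rewrite // (tnth_nth m0).
  by rewrite tnth_mktuple.
Qed.
End Complete.

End SkolemForm.

Theorem skolem_expressible sg (U G : finType) A k (gR g0 : G) (v : k.-tuple nat)
    (kA : k <= A) (psi : qf sg (wvar U G A)) (M : finModel sg) V (X : set (assignment M)) :
  team_on V X -> [set x | x \in v] `<=` V -> X !=set0 ->
  sat X (skolem_formula gR g0 v kA psi) <->
  exists F : G -> seq M -> M,
    (forall a : k.-tuple M, team_rel v X a <-> F gR a = F g0 [::]) /\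
    (forall env, holds (wval F env) psi).
Proof.
move=> XV vV [s Xs]; rewrite (sat_prefixed _ _ _ XV vV).
split=> [[T [cov TR Tpsi Tts]]|[F [FR Fpsi]]]; last exact: skolem_team FR Fpsi.
apply: (skolem_functions (T := T) _ cov) => //.
have /card_gt0P[m0 _] := ltnW (dom_gt1 M).
exists [tuple odflt m0 (s (tnth v i)) | i < k], s => // i; rewrite tnth_mktuple.
case E: (s _) => [//|]; have := XV _ Xs (tnth v i).
by case=> _ /(_ (vV _ (mem_tnth _ _))); rewrite E.
Qed.

(** * Codes of finite structures *)

Section LexRank.
Variables (T : eqType) (e : seq T).
Hypotheses (e_uniq : uniq e) (e_all : e =i predT).
Local Notation n := (size e).

(** Numeral in base [n], most significant digit first; by [nth_lex] it is the position in
    [lex_tuples]. *)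
Fixpoint lrank (a : seq T) : nat :=
  if a is x :: a' then index x e * n ^ size a' + lrank a' else 0.

Lemma index_lt x : index x e < n.
Proof. by rewrite index_mem e_all. Qed.

Lemma index_all_inj x y : index x e = index y e -> x = y.
Proof. by move=> E; rewrite -(nth_index x (s := e) (e_all x)) E nth_index ?e_all. Qed.

Lemma lrank_lt a : lrank a < n ^ size a.
Proof.
elim: a => [|x a IH] /=; first by rewrite expn0.
have := index_lt x; rewrite expnS -(leq_pmul2r (m := n ^ size a)); last exact: leq_trans IH.
by nia.
Qed.

Lemma lrank_inj a b : size a = size b -> lrank a = lrank b -> a = b.
Proof.
elim: a b => [|x a IH] [|y b] //= [ab] E.
have la := lrank_lt a; have lb := lrank_lt b; move: E lb; rewrite -ab => E lb.
have xy : index x e = index y e by nia.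
by rewrite (index_all_inj xy) (IH b) //; move: E; rewrite xy; lia.
Qed.

Lemma lrank_surj q j : j < n ^ q -> exists2 a, size a = q & lrank a = j.
Proof.
elim: q j => [|q IH] j; first by rewrite expn0; case: j => // _; exists [::].
rewrite expnS => jn; have q0 : 0 < n ^ q by case: (n ^ q) jn; rewrite ?muln0.
have [a aq aj] := IH _ (ltn_pmod j q0).
have jq : j %/ n ^ q < n by rewrite ltn_divLR.
have [x0 _] : exists x0 : T, True by case: (e) jq => // x0; exists x0.
exists (nth x0 e (j %/ n ^ q) :: a); rewrite /= aq // aj index_uniq //.
by rewrite -divn_eq.
Qed.

Lemma size_lex q : size (lex_tuples e q) = n ^ q.
Proof.
by elim: q => //= q IH; rewrite size_allpairs IH expnS.
Qed.

Lemma nth_lex q (a a0 : q.-tuple T) : nth a0 (lex_tuples e q) (lrank a) = a.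
Proof.
elim: q a a0 => [|q IH] a a0; first by rewrite [LHS]tuple0 [RHS]tuple0.
case/tupleP: a => x a.
have -> : lrank [tuple of x :: a] = index x e * n ^ q + lrank a.
  by rewrite /= size_tuple.
(* The list of first components is generalised for the induction, while the remaining components
   still range over all of [e]. *)
have nthp (s : seq T) i : i < size s ->
    nth a0 [seq cons_tuple y b | y <- s, b <- lex_tuples e q] (i * n ^ q + lrank a) =
    cons_tuple (nth x s i) (nth a (lex_tuples e q) (lrank a)).
  have ra : lrank a < size (lex_tuples e q) by rewrite size_lex -{2}(size_tuple a) lrank_lt.
  elim: s i => //= y s IHs [|i] si; rewrite nth_cat size_map size_lex.
    by rewrite -size_lex ra (nth_map a).
  by rewrite ltnNge mulSn -addnA leq_addr /= addKn IHs.
by rewrite [LHS]nthp ?index_lt // IH nth_index ?e_all //; apply/val_inj.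
Qed.

Lemma mem_lex q (a : q.-tuple T) : a \in lex_tuples e q.
Proof.
by rewrite -[a](nth_lex a a) mem_nth // size_lex -{2}(size_tuple a) lrank_lt.
Qed.

Lemma nth_table q (R : set (q.-tuple T)) (a : q.-tuple T) :
  nth false (table e R) (lrank a) = `[< R a >].
Proof.
rewrite (nth_map a) ?nth_lex // size_lex -{2}(size_tuple a); exact: lrank_lt.
Qed.

Lemma size_table q (R : set (q.-tuple T)) : size (table e R) = n ^ q.
Proof. by rewrite size_map size_lex. Qed.

End LexRank.

Lemma lex_tuples_map (T T' : Type) (h : T -> T') (e : seq T) q :
  lex_tuples (map h e) q = map (map_tuple h) (lex_tuples e q).
Proof.
elim: q => [|q IH] /=; first by congr [:: _]; apply: val_inj.
rewrite IH; elim: e {IH} (lex_tuples e q) => //= x e IH s.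
rewrite IH map_cat; congr (_ ++ _); rewrite -!map_comp; apply: eq_map => a /=.
exact: val_inj.
Qed.

(** * The code as a concatenation of tables *)

Section Blocks.
Variables (sg : signature) (k : nat).

(* Every part of the code of a structure is a [table]: the unary size is that of the
   full unary relation and the separator that of the empty relation of arity 0. *)
Inductive block := BDom | BSep | BRel of rsym sg | BFun of Defs.fsym sg | BTeam.

Definition barity (b : block) : nat :=
  match b with
  | BDom => 1
  | BSep => 0
  | BRel r => rarity r
  | BFun f => (farity f).+1
  | BTeam => k
  end.

Definition bset (M : finModel sg) (R : set (k.-tuple M)) (b : block) :
    set ((barity b).-tuple M) :=
  match b with
  | BDom => setT
  | BSep => set0
  | BRel r => @rinterp sg M r
  | BFun f => @graph sg M f
  | BTeam => R
  end.

Arguments bset [M] R b _.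

Definition blocks : seq block :=
  [:: BDom, BSep & map BRel (enum (rsym sg)) ++ map BFun (enum (Defs.fsym sg)) ++ [:: BTeam]].

Definition bsizes (n : nat) : seq nat := [seq n ^ barity b | b <- blocks].

Section Encode.
Variables (M : finModel sg) (R : set (k.-tuple M)) (e : seq M).
Hypotheses (e_uniq : uniq e) (e_all : e =i predT).

Lemma size_enumeration : size e = #|M|.
Proof. by rewrite -(card_uniqP e_uniq) (eq_card e_all). Qed.

Lemma encode_blocks : encode R e = flatten [seq table e (bset R b) | b <- blocks].
Proof.
rewrite /encode /blocks /= map_cat map_cat !flatten_cat -!map_comp /= cats0.
congr (_ ++ _); rewrite /table.
  have -> : [seq `[< bset R BDom a >] | a <- lex_tuples e 1] = nseq (size (lex_tuples e 1)) true.
    by elim: (lex_tuples e 1) => //= a s ->; congr (_ :: _); apply/asboolP.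
  by rewrite size_lex expn1 size_enumeration.
by congr (_ :: _); apply/esym/asboolP => -[].
Qed.

Lemma shape_blocks : shape [seq table e (bset R b) | b <- blocks] = bsizes (size e).
Proof. by rewrite /shape -map_comp; apply: eq_map => b /=; rewrite size_table. Qed.

Lemma size_encode : size (encode R e) = sumn (bsizes #|M|).
Proof. by rewrite encode_blocks size_flatten shape_blocks size_enumeration. Qed.

Lemma nth_encode i (a : (barity (nth BDom blocks i)).-tuple M) : i < size blocks ->
  nth false (encode R e) (sumn (take i (bsizes (size e))) + lrank e a) =
  `[< bset R _ a >].
Proof.
move=> ib; rewrite encode_blocks -shape_blocks.
set ts := map _ _; rewrite -/(flatten_index (shape ts) i (lrank e a)) nth_flatten.
have ash : lrank e a < nth 0 (shape ts) i.
  by rewrite shape_blocks (nth_map BDom) // -{2}(size_tuple a) lrank_lt.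
by rewrite flatten_indexKl // flatten_indexKr // (nth_map BDom) // nth_table.
Qed.

End Encode.
End Blocks.

Arguments bset [sg k M] R b _.

(** Every block occurs in [blocks], so facts proved for the parts of the code by their number
    transfer to all blocks. *)
Lemma blocks_ind sg (P : block sg -> Prop) :
  (forall i, i < size (blocks sg) -> P (nth (BDom sg) (blocks sg) i)) -> forall b, P b.
Proof.
have nth_catR (T : Type) x (s t : seq T) i : nth x (s ++ t) (size s + i) = nth x t i.
  by rewrite nth_cat ltnNge leq_addr addKn.
move=> H [||r|f|]; first exact: (H 0).
- exact: (H 1).
- have := H (index r (enum (rsym sg))).+2; rewrite /blocks /= nth_cat size_map.
  rewrite index_mem mem_enum (nth_map r) ?index_mem ?mem_enum // nth_index ?mem_enum //.
  by apply; rewrite !ltnS size_cat size_map ltn_addr // index_mem mem_enum.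
- have := H (size (map (@BRel sg) (enum (rsym sg))) + index f (enum (Defs.fsym sg))).+2.
  rewrite /blocks /= nth_catR nth_cat (size_map (@BFun sg)) index_mem mem_enum.
  rewrite (nth_map f) ?index_mem ?mem_enum // nth_index ?mem_enum //; apply.
  by rewrite !ltnS !size_cat ltn_add2l ltn_addr // size_map index_mem mem_enum.
- have := H (size (map (@BRel sg) (enum (rsym sg))) +
             (size (map (@BFun sg) (enum (Defs.fsym sg))) + 0)).+2.
  rewrite /blocks /= !nth_catR /=; apply.
  by rewrite !ltnS !size_cat ltn_add2l ltn_add2l.
Qed.

(** The leading ones give the size, hence the lengths of all tables. So equal codes have equal
    tables, and matching the two enumerations entry by entry is an isomorphism. *)
Lemma encode_inj sg k (M N : finModel sg) (R : set (k.-tuple M)) (R' : set (k.-tuple N))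
    (e : seq M) (e' : seq N) :
  uniq e -> e =i predT -> uniq e' -> e' =i predT -> encode R e = encode R' e' ->
  exists2 h, isomorphism h & forall a : k.-tuple M, R a <-> R' (map_tuple h a).
Proof.
move=> eu ea eu' ea' E.
have idx n s : index false (nseq n true ++ false :: s) = n.
  by rewrite index_cat mem_nseq andbF size_nseq /= addn0.
have cMN : #|M| = #|N|.
  by move/(congr1 (index false)): E; rewrite /encode !idx.
have se : size e = size e' by rewrite !size_enumeration.
have /card_gt0P[y0 _] := ltnW (dom_gt1 N).
have /card_gt0P[x0 _] := ltnW (dom_gt1 M).
pose h x := nth y0 e' (index x e).
have he : e' = map h e.
  apply: (@eq_from_nth _ y0); first by rewrite size_map se.
  move=> i; rewrite -se => ie; rewrite (nth_map x0) // /h index_uniq //.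
have h_bij : bijective h.
  exists (fun y => nth x0 e (index y e')) => [x|y]; rewrite /h.
    by rewrite index_uniq ?nth_index ?ea // -se index_mem ea.
  by rewrite index_uniq ?nth_index ?ea' // se index_mem ea'.
have tabs i : i < size (blocks sg) ->
    table e (bset R (nth (BDom sg) (blocks sg) i)) =
    table e' (bset R' (nth (BDom sg) (blocks sg) i)).
  have Es : [seq table e (bset R b) | b <- blocks sg] =
            [seq table e' (bset R' b) | b <- blocks sg].
    apply: eq_from_flatten_shape; first by rewrite -!encode_blocks.
    by rewrite !shape_blocks se.
  move=> ib; move/(congr1 (fun s => nth [::] s i)): Es.
  by rewrite !(nth_map (BDom sg)).
have block_iso : forall b (a : (barity k b).-tuple M),
    bset R b a <-> bset R' b (map_tuple h a).
  apply: (@blocks_ind sg) => i /tabs; rewrite /table he lex_tuples_map -map_comp.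
  move=> /eq_in_map Ea a; have := Ea a (mem_lex eu ea a) => /= Eaa.
  by split=> /asboolP ?; apply/asboolP; congruence.
exists h; last exact: (block_iso (BTeam sg)).
split=> // [f a|r]; last exact: (block_iso (BRel r)).
(* Functions are compared through their graphs, which contain the value followed by the
   arguments. *)
have /(block_iso (BFun f)) : bset R (BFun f) [tuple of finterp a :: a].
  by rewrite /= /graph /= theadE; congr (finterp _); apply: val_inj.
rewrite /= /graph /= => E'.
transitivity (thead (map_tuple h [tuple of finterp a :: a])); first by [].
by rewrite E'; congr (finterp _); apply: val_inj.
Qed.

(** A code in the language may stem from another structure, but then from an isomorphic one. *)
Lemma language_encode sg k (C : team_property sg k) (M : finModel sg)
    (R : set (k.-tuple M)) (e : seq M) :
  closed_under_iso C -> uniq e -> e =i predT -> language C (encode R e) <-> C M R.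
Proof.
move=> Ciso eu ea; split=> [[N [R' [e' [eu' ea' CN E]]]]|CM]; last by exists M, R, e.
have [h hiso hR] := encode_inj eu' ea' eu ea (esym E).
exact: Ciso hiso _ _ hR CN.
Qed.

(** * Bounding code length and time by powers of the size *)

Lemma poly_bound (p : {poly nat}) : exists c d, forall m, 0 < m -> p.[m]%R <= c * m ^ d.
Proof.
elim/poly_ind: p => [|p a [c [d IH]]].
  by exists 0, 0 => m _; rewrite horner0.
exists (c + a), d.+1 => m m0; rewrite hornerMXaddC.
have mul_add (x : nat) : (x * m + a)%R = (x * m + a)%N by [].
have q0 : 0 < m * m ^ d by rewrite -expnS expn_gt0 m0.
rewrite expnS mul_add mulnDl leq_add ?leq_pmulr //.
by rewrite [_ * m]mulnC mulnCA leq_mul2l IH ?orbT.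
Qed.

Lemma sumn_bsizes_bound sg k : exists d, forall n, 1 < n -> sumn (bsizes sg k n) <= n ^ d.
Proof.
rewrite /bsizes; elim: (blocks sg) => [|b s [d IH]].
  by exists 0.
exists (barity k b + d).+1 => n n1 /=.
have := IH n n1; rewrite expnS expnD.
have : 0 < n ^ d by rewrite expn_gt0 ltnW.
have : 0 < n ^ barity k b by rewrite expn_gt0 ltnW.
move: (n ^ d) (n ^ _) => y x x0 y0 Sy; apply: (@leq_trans (2 * (x * y))); first by nia.
by rewrite leq_mul2r n1 orbT.
Qed.

(** The [.+1] leaves room to number one step beyond the time bound, which is what contradicts the
    bound. *)
Lemma time_bound sg k (p : {poly nat}) : exists d, forall n, 1 < n ->
  sumn (bsizes sg k n) <= n ^ d /\ (p.[sumn (bsizes sg k n)]%R).+1 < n ^ d.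
Proof.
have [d1 H1] := sumn_bsizes_bound sg k; have [c [d2 H2]] := poly_bound p.
(* [d1] bounds the code length, [d1 * d2] accounts for its power in the time bound, and [n ^ c.+2]
   exceeds the coefficient with room for the strict inequality. *)
exists (d1 + (c.+2 + d1 * d2)) => n n1; have l1 := H1 n n1.
have n0 : 0 < n by apply: ltnW.
have w0 : 0 < sumn (bsizes sg k n).
  by rewrite /bsizes /= expn1 addn_gt0 n0.
have l2 : p.[sumn (bsizes sg k n)]%R <= c * n ^ (d1 * d2).
  apply: leq_trans (H2 _ w0) _; rewrite leq_mul2l expnM; apply/orP; right.
  by case: (d2) => // d3; rewrite leq_exp2r.
have lc : c.+2 < n ^ c.+2 by apply: ltn_expl.
have q1 : 0 < n ^ (d1 * d2) by rewrite expn_gt0 n0.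
have q2 : 0 < n ^ d1 by rewrite expn_gt0 n0.
move: l1 l2 lc q1 q2; rewrite !expnD.
move: (p.[_])%R (n ^ d1) (n ^ c.+2) (n ^ (d1 * d2)) => P x y z l1 l2 lc z0 x0.
split; first by apply: leq_trans l1 _; rewrite leq_pmulr // muln_gt0 z0; lia.
apply: (@leq_trans (y * z)); last by rewrite leq_pmull.
by apply: (@leq_trans (c.+2 * z)); [nia|rewrite leq_mul2r ltnW ?orbT].
Qed.

(** * The formula describing a run *)

Section Symbols.
Variables (sg : signature) (N : ntm).

Local Notation tsym := (option (bool + ntm_work N)).

(* New state, written symbol, and whether the head moves right. *)
Definition trans_label := (ntm_state N * tsym * bool)%type.

(* [SPos i] relates an entry of block i of the code to its position, [SBlank] holds
   of the positions behind the code, and [STrans l] of the times at which the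
   machine makes the transition l. *)
Inductive sym :=
| SZero | SLast | SSucc | SLt
| STeam
| SPos of 'I_(size (blocks sg))
| SBlank
| SState of ntm_state N
| SHead
| SCell of tsym
| STrans of trans_label.

(** A sum of finite types through which [sym] becomes finite; ['I_7] serves the seven constructors
    without argument. *)
Definition sym_code := ('I_7 + 'I_(size (blocks sg)) + ntm_state N + tsym + trans_label)%type.

Definition sym_encode (g : sym) : sym_code :=
  match g with
  | SZero => inl (inl (inl (inl (inord 0))))
  | SLast => inl (inl (inl (inl (inord 1))))
  | SSucc => inl (inl (inl (inl (inord 2))))
  | SLt => inl (inl (inl (inl (inord 3))))
  | STeam => inl (inl (inl (inl (inord 4))))
  | SBlank => inl (inl (inl (inl (inord 5))))
  | SHead => inl (inl (inl (inl (inord 6))))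
  | SPos i => inl (inl (inl (inr i)))
  | SState q => inl (inl (inr q))
  | SCell a => inl (inr a)
  | STrans l => inr l
  end.

Definition sym_decode (c : sym_code) : sym :=
  match c with
  | inl (inl (inl (inl i))) =>
      nth SZero [:: SZero; SLast; SSucc; SLt; STeam; SBlank; SHead] i
  | inl (inl (inl (inr i))) => SPos i
  | inl (inl (inr q)) => SState q
  | inl (inr a) => SCell a
  | inr l => STrans l
  end.

Lemma sym_encodeK : cancel sym_encode sym_decode.
Proof. by case=> //=; rewrite inordK. Qed.

HB.instance Definition _ := Finite.copy sym (can_type sym_encodeK).

End Symbols.

(** * Clauses for the input tape and the transitions *)

Section Clauses.
Variables (sg : signature) (N : ntm).
Local Notation tsym := (option (bool + ntm_work N)).
Local Notation nb := (size (blocks sg)).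
Local Notation sym := (sym sg N).

(* Stated for an arbitrary algebra T of truth values, so that the same text
   yields both the formulas (T = qf) and their semantics (T = bool). *)
Variables (X T : Type) (top : T) (imp : T -> T -> T) (neg : T -> T).
Variable any : forall I : Type, seq I -> (I -> T) -> T.
Variables (rel : sym -> seq X -> T) (zero last : seq X -> T).
Variables (succ same : seq X -> seq X -> T) (bit : 'I_nb -> seq X -> T).

Local Notation "a ==>> b" := (imp a b) (at level 55, right associativity).
Local Notation guard b c := (if b then c else top).

Definition static_clauses (t p p' : seq X) : seq T :=
  [:: rel (SBlank _ _) p ==>> succ p p' ==>> rel (SBlank _ _) p';
      rel (SBlank _ _) p ==>> zero t ==>> rel (SCell _ None) (t ++ p);
      zero t ==>> rel (SState _ (ntm_start N)) t;
      zero t ==>> zero p ==>> rel (SHead _ _) (t ++ p)].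

(** The input is laid out by recursion along successors, because the formula has no arithmetic to
    say that [p] is the start of block [i] plus the rank of [a]. *)
Definition pos_clauses (i : 'I_nb) (a a' t p p' : seq X) : seq T :=
  [:: guard (i == 0 :> nat) (zero a ==>> zero p ==>> rel (SPos _ i) (a ++ p));
      rel (SPos _ i) (a ++ p) ==>> succ a a' ==>> succ p p' ==>>
        rel (SPos _ i) (a' ++ p');
      guard (i.+1 == nb) (rel (SPos _ i) (a ++ p) ==>> last a ==>> succ p p' ==>>
        rel (SBlank _ _) p');
      rel (SPos _ i) (a ++ p) ==>> zero t ==>> bit i a ==>>
        rel (SCell _ (Some (inl true))) (t ++ p);
      rel (SPos _ i) (a ++ p) ==>> zero t ==>> neg (bit i a) ==>>
        rel (SCell _ (Some (inl false))) (t ++ p)].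

Definition next_clause (i j : 'I_nb) (a a' p p' : seq X) : T :=
  guard (j == i.+1 :> nat) (rel (SPos _ i) (a ++ p) ==>> last a ==>> zero a' ==>>
    succ p p' ==>> rel (SPos _ j) (a' ++ p')).

(** If no transition applies, the disjunction is empty and hence false: a nonaccepting configuration
    must not be stuck. *)
Definition choice_clause (q : ntm_state N) (b : tsym) (t p : seq X) : T :=
  guard (~~ ntm_accept q) (rel (SState _ q) t ==>> rel (SHead _ _) (t ++ p) ==>>
    rel (SCell _ b) (t ++ p) ==>>
    any [seq l <- enum {: trans_label N} |
          ntm_delta q b (l.1, if l.2 then MoveR else MoveL)]
        (fun l => rel (STrans _ l) t)).

(** The third clause is the frame condition on cells away from the head; the last one treats a left
    move from cell 0. *)
Definition trans_clauses (l : trans_label N) (b : tsym) (t t' p p' : seq X) : seq T :=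
  [:: rel (STrans _ l) t ==>> succ t t' ==>> rel (SState _ l.1.1) t';
      rel (STrans _ l) t ==>> succ t t' ==>> rel (SHead _ _) (t ++ p) ==>>
        rel (SCell _ l.1.2) (t' ++ p);
      rel (STrans _ l) t ==>> succ t t' ==>> rel (SHead _ _) (t ++ p) ==>>
        neg (same p p') ==>> rel (SCell _ b) (t ++ p') ==>> rel (SCell _ b) (t' ++ p');
      guard l.2 (rel (STrans _ l) t ==>> succ t t' ==>> rel (SHead _ _) (t ++ p) ==>>
        succ p p' ==>> rel (SHead _ _) (t' ++ p'));
      guard (~~ l.2) (rel (STrans _ l) t ==>> succ t t' ==>> rel (SHead _ _) (t ++ p) ==>>
        succ p' p ==>> rel (SHead _ _) (t' ++ p'));
      guard (~~ l.2) (rel (STrans _ l) t ==>> succ t t' ==>> rel (SHead _ _) (t ++ p) ==>>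
        zero p ==>> rel (SHead _ _) (t' ++ p))].

End Clauses.

(** * The universal formula *)

Section Formula.
Variables (sg : signature) (k : nat) (N : ntm) (d A : nat).
Local Notation tsym := (option (bool + ntm_work N)).
Local Notation nb := (size (blocks sg)).
Local Notation sym := (sym sg N).
Local Notation U := ('I_6 * 'I_A.+1)%type.
Local Notation W := (wvar U sym A.+1).
Implicit Types s t : seq U.

(** A list longer than [A.+1] would be replaced by the empty one, hence the size conditions
    below. *)
Definition fapp (g : sym) s : W := inr (g, insub_bseq A.+1 s).
(* A relation is represented by a function that takes the value zero where it holds. *)
Definition relF (g : sym) s : qf sg W := QEq sg (fapp g s) (fapp (SZero _ _) [::]).

Definition zeroF s : qf sg W := QBig s (fun x => QEq sg (inl x) (fapp (SZero _ _) [::])).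
Definition lastF s : qf sg W := QBig s (fun x => QEq sg (inl x) (fapp (SLast _ _) [::])).

(** The guessed successor function also has a value at the last element, where it means nothing; the
    comparison excludes it. *)
Definition succ1F (x y : U) : qf sg W :=
  QAnd (relF (SLt _ _) [:: x; y]) (QEq sg (fapp (SSucc _ _) [:: x]) (inl y)).

(** Increment of a numeral, most significant digit first; the second disjunct is the carry. *)
Fixpoint succF s t : qf sg W :=
  match s, t with
  | x :: s', y :: t' => QOr (QAnd (QEq sg (inl x) (inl y)) (succF s' t'))
                            (QAnd (succ1F x y) (QAnd (lastF s') (zeroF t')))
  | _, _ => QNot (QTrue _ _)
  end.

Definition sameF s t : qf sg W := QEqs sg (map inl s) (map inl t).

Definition var0 : U := (ord0, ord0).

Definition bitF (b : block sg) s : qf sg W :=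
  match b with
  | BDom => QTrue _ _
  | BSep => QNot (QTrue _ _)
  | BRel r => QRel (fun j : 'I_(rarity r) => inl (nth var0 s j))
  | BFun f => QFun (fun j : 'I_(farity f) => inl (nth var0 s j.+1)) (inl (nth var0 s 0))
  | BTeam => relF (STeam _ _) s
  end.

Definition nth_block (i : 'I_nb) := nth (BDom sg) (blocks sg) i.

(** The six groups of variables are for the two times, two cells and two block entries that a clause
    may mention. *)
Definition vars (b : 'I_6) q : seq U := [seq (b, i) | i <- take q (enum 'I_A.+1)].

(** Guessed functions are applied to variables only, so a value such as the zero is compared through
    a variable [z] assumed equal to it. [SZero], [SLast] and [SSucc] are Skolem functions that keep
    the axioms universal. *)
Definition order_axioms : qf sg W :=
  let x := (inord 0, ord0) in let y := (inord 1, ord0) in let z := (inord 2, ord0) in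
  let lt u v := relF (SLt _ _) [:: u; v] in
  let eq u v : qf sg W := QEq sg (inl u) (inl v) in
  QBig [:: QNot (lt x x);
    QImp (lt x y) (QImp (lt y z) (lt x z));
    QOr (eq x y) (QOr (lt x y) (lt y x));
    QImp (QEq sg (inl z) (fapp (SZero _ _) [::])) (QImp (QNot (eq x z)) (lt z x));
    QImp (QEq sg (inl z) (fapp (SLast _ _) [::])) (QImp (QNot (eq x z)) (lt x z));
    QImp (lt x y) (QImp (QEq sg (inl z) (fapp (SSucc _ _) [:: x]))
      (QAnd (lt x z) (QImp (QNot (eq z y)) (lt z y))))] id.

Let imp := @QImp sg W.
Let top := QTrue sg W.
Let neg := @QNot sg W.
Let any := fun I => @QEx sg W I.
Let bit i := bitF (nth_block i).
Let t := vars (inord 0) d.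
Let t' := vars (inord 1) d.
Let p := vars (inord 2) d.
Let p' := vars (inord 3) d.
Let a i := vars (inord 4) (barity k (nth_block i)).
Let a' i := vars (inord 5) (barity k (nth_block i)).

Definition static_formula := QBig (static_clauses imp relF zeroF succF t p p') id.

Definition pos_formula := QBig (enum 'I_nb) (fun i =>
  QBig (pos_clauses top imp neg relF zeroF lastF succF bit i (a i) (a' i) t p p') id).

Definition next_formula := QBig (enum {: 'I_nb * 'I_nb}) (fun ij =>
  next_clause top imp relF zeroF lastF succF ij.1 ij.2 (a ij.1) (a' ij.2) p p').

Definition choice_formula := QBig (enum {: ntm_state N * tsym}) (fun qb =>
  choice_clause top imp any relF qb.1 qb.2 t p).

Definition trans_formula := QBig (enum {: trans_label N * tsym}) (fun lb =>
  QBig (trans_clauses top imp neg relF zeroF succF sameF lb.1 lb.2 t t' p p') id).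

Definition fagin : qf sg W :=
  QAnd order_axioms (QAnd static_formula (QAnd pos_formula (QAnd next_formula
    (QAnd choice_formula trans_formula)))).

End Formula.

(** * Truth of the formula in terms of ranks *)

Section Semantics.
Variables (sg : signature) (k : nat) (N : ntm) (d A : nat).
Local Notation tsym := (option (bool + ntm_work N)).
Local Notation nb := (size (blocks sg)).
Local Notation sym := (sym sg N).
Local Notation U := ('I_6 * 'I_A.+1)%type.
Local Notation W := (wvar U sym A.+1).
Local Notation q i := (barity k (nth_block i)).
Hypothesis A_gt0 : 0 < A.
Hypothesis dA : d + d <= A.+1.
Hypothesis qA : forall i : 'I_nb, q i + d <= A.+1.
Variables (M : finModel sg) (R : set (k.-tuple M)) (F : sym -> seq M -> M).

Definition relB g l := F g l == F (SZero _ _) [::].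

Definition zeroB (e l : seq M) := lrank e l == 0.
Definition lastB (e l : seq M) := (lrank e l).+1 == size e ^ size l.
Definition succB (e l l' : seq M) := lrank e l' == (lrank e l).+1.
Definition sameB (l l' : seq M) := l == l'.
Definition bitB (b : block sg) (l : seq M) :=
  `[< exists2 a : (barity k b).-tuple M, bset R b a & l = a >].

Definition order_ok (e : seq M) := [/\ uniq e, e =i predT,
  forall x, (x == F (SZero _ _) [::]) = (index x e == 0),
  forall x, (x == F (SLast _ _) [::]) = ((index x e).+1 == size e) &
  forall x y, relB (SLt _ _) [:: x; y] && (F (SSucc _ _) [:: x] == y) =
              (index y e == (index x e).+1)].

Definition run_clauses e (t t' p p' : seq M) (a a' : 'I_nb -> seq M) :=
  [/\ all id (static_clauses implb relB (zeroB e) (succB e) t p p'),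
      forall i, all id (pos_clauses true implb negb relB (zeroB e) (lastB e) (succB e)
        (fun i => bitB (nth_block i)) i (a i) (a' i) t p p'),
      forall i j, next_clause true implb relB (zeroB e) (lastB e) (succB e)
        i j (a i) (a' j) p p',
      forall q b, choice_clause true implb (fun I xs f => has f xs) relB q b t p &
      forall l b, all id (trans_clauses true implb negb relB (zeroB e) (succB e) sameB
        l b t t' p p')].

Section Env.
Variable env : U -> M.
Local Notation eholds := (holds (wval F env)).
Implicit Types s t : seq U.

Lemma wval_fapp g s : size s <= A.+1 -> wval F env (fapp g s) = F g (map env s).
Proof. by move=> sA /=; rewrite /insub_bseq val_insubd sA. Qed.

Lemma holds_eq_fapp x g : eholds (QEq sg (inl x) (fapp g [::])) = (env x == F g [::]).
Proof. by rewrite -[LHS]/(env x == wval F env (fapp g [::])) wval_fapp. Qed.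

Lemma holds_rel g s : size s <= A.+1 -> eholds (relF g s) = relB g (map env s).
Proof. move=> sA; rewrite -[LHS]/(wval F env (fapp g s) == wval F env (fapp (SZero _ _) [::])).
by rewrite !wval_fapp. Qed.

Lemma holds_same s t : size s = size t ->
  eholds (sameF sg N s t) = sameB (map env s) (map env t).
Proof. by move=> st; rewrite /sameF holds_eqs ?size_map // -!map_comp. Qed.

Lemma bitB_tuple b (a : (barity k b).-tuple M) : bitB b a = `[< bset R b a >].
Proof.
apply/asboolP/asboolP => [[a' Ra' /val_inj -> //]|Ra]; by exists a.
Qed.

Lemma holds_bit b s : (forall a : k.-tuple M, R a <-> F (STeam _ _) a = F (SZero _ _) [::]) ->
  size s = barity k b -> barity k b <= A.+1 -> eholds (bitF N b s) = bitB b (map env s).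
Proof.
move=> RF sb bA.
have [a sa] : exists a : (barity k b).-tuple M, map env s = a.
  by exists (Tuple (introT eqP (etrans (size_map env s) sb))).
rewrite sa bitB_tuple; have nth_env j x : j < size s -> env (nth (var0 A) s j) = nth x a j.
  by move=> js; rewrite -sa (nth_map (var0 A)).
case: b sb bA a sa nth_env => [||r|f|] sb bA a sa nth_env.
- exact/esym/asboolP.
- by apply/esym/asboolP => -[].
- rewrite /=; congr (`[< rinterp _ >]); apply: eq_from_tnth => j.
  by rewrite tnth_mktuple (tnth_nth (tnth a j)) -nth_env ?sb.
- rewrite /=; have [x _] : exists x : M, True by exists (thead a).
  have -> : env (nth (var0 A) s 0) = thead a by rewrite (nth_env 0 x) ?sb // /thead (tnth_nth x).
  have -> : [tuple env (nth (var0 A) s (nat_of_ord j).+1) | j < farity f] = behead_tuple a.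
    apply: eq_from_tnth => j; rewrite tnth_mktuple (nth_env _ x) ?sb ?ltnS //.
    by rewrite (tnth_nth x) nth_behead.
  by rewrite eq_sym; apply/eqP/asboolP.
- rewrite [LHS]holds_rel ?sb // sa /relB; apply/eqP/asboolP; first by move=> /RF.
  by move=> /RF.
Qed.

Lemma size_vars b q0 : q0 <= A.+1 -> size (vars A b q0) = q0.
Proof.
by move=> qA0; rewrite size_map size_take size_enum_ord; case: ltngtP qA0.
Qed.

Hypothesis RF : forall a : k.-tuple M, R a <-> F (STeam _ _) a = F (SZero _ _) [::].
Variable e : seq M.
Hypothesis eF : order_ok e.

Let e_uniq : uniq e. Proof. by case: eF. Qed.
Let e_all : e =i predT. Proof. by case: eF. Qed.

Lemma lrank_gt0 s : 0 < size e ^ size (map env s).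
Proof. by apply: leq_trans (lrank_lt e_uniq e_all (map env s)). Qed.

Lemma holds_zero s : eholds (zeroF sg N s) = zeroB e (map env s).
Proof.
rewrite /zeroF holds_big (eq_all (fun x => holds_eq_fapp x _)) /zeroB.
elim: s => //= x s ->; case: eF => _ _ /(_ (env x)) -> _ _.
by rewrite addn_eq0 muln_eq0 [_ ^ _ == 0]eqn0Ngt lrank_gt0 orbF.
Qed.

Lemma holds_last s : eholds (lastF sg N s) = lastB e (map env s).
Proof.
rewrite /lastF holds_big (eq_all (fun x => holds_eq_fapp x _)).
elim: s => //= x s ->; case: eF => _ _ _ /(_ (env x)) -> _.
have := lrank_lt e_uniq e_all (map env s); have := index_lt e_all (env x).
rewrite /lastB /= expnS; move: (size e) (lrank e _) (index _ e) (_ ^ _) => n r i P ni rP.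
apply/andP/eqP => [[/eqP <- /eqP <-]|E]; first by lia.
have Ei : i.+1 = n by nia.
by rewrite Ei eqxx; split=> //; apply/eqP; nia.
Qed.

Lemma holds_succ s t : size s = size t ->
  eholds (succF sg N s t) = succB e (map env s) (map env t).
Proof.
elim: s t => [|x s IH] [|y t] // [st].
rewrite -[LHS]/(eholds (QOr (QAnd (QEq sg (inl x) (inl y)) (succF sg N s t))
  (QAnd (succ1F sg N x y) (QAnd (lastF sg N s) (zeroF sg N t))))).
rewrite holds_or !holds_and holds_rel // IH // holds_last holds_zero.
have -> : eholds (QEq sg (inl x : W) (inl y)) = (index (env x) e == index (env y) e).
  rewrite -[LHS]/(env x == env y).
  by apply/eqP/eqP => [->|/(index_all_inj e_all)].
have -> : eholds (QEq sg (fapp (SSucc sg N) [:: x] : W) (inl y)) =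
    (F (SSucc _ _) [:: env x] == env y).
  by rewrite -[LHS]/(wval F env (fapp _ _) == _) wval_fapp.
case: eF => _ _ _ _ /(_ (env x) (env y)) /= Es.
rewrite Es /succB /zeroB /lastB /=.
have := lrank_lt e_uniq e_all (map env s); have := lrank_lt e_uniq e_all (map env t).
rewrite !size_map st.
move: (lrank e _) (lrank e _) (index _ e) (index _ e) (_ ^ _) => r r' i j P rP rP'.
apply/orP/eqP.
  case=> [/andP[/eqP <- /eqP ->]|/and3P[/eqP -> /eqP E /eqP ->]]; first by lia.
  by rewrite mulSn; lia.
(* Tail ranks lie below [P], so the leading digit can only change by a carry: [j] is [i.+1], the
   first tail is last and the second one zero. *)
move=> E; case: (ltngtP i j) => [ij|ij|ij].
- by right; have Ej : j = i.+1 by [nia]; subst j; apply/and3P; split=> //; nia.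
- nia.
- by left; apply/eqP; subst j; lia.
Qed.
Lemma holds_not (c : qf sg W) : eholds (QNot c) = ~~ eholds c.
Proof. by []. Qed.

Lemma holds_guard (b : bool) (c : qf sg W) :
  eholds (if b then c else QTrue _ _) = if b then eholds c else true.
Proof. by case: b. Qed.

Lemma all_holds (cs : seq (qf sg W)) : eholds (QBig cs id) = all id (map eholds cs).
Proof. by rewrite holds_big all_map. Qed.

Local Arguments holds : simpl never.

Section Lists.
Variables t t' p p' : seq U.
Hypotheses (td : size t = d) (t'd : size t' = d) (pd : size p = d) (p'd : size p' = d).

Lemma holds_rel1 g s : size s = d -> eholds (relF g s) = relB g (map env s).
Proof. by move=> sd; apply: holds_rel; rewrite sd (leq_trans (leq_addr d d)). Qed.

Lemma holds_rel2 g s s' : size s = d -> size s' = d ->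
  eholds (relF g (s ++ s')) = relB g (map env s ++ map env s').
Proof. by move=> sd s'd; rewrite -map_cat; apply: holds_rel; rewrite size_cat sd s'd. Qed.

Lemma holds_relq g (i : 'I_nb) s s' : size s = q i -> size s' = d ->
  eholds (relF g (s ++ s')) = relB g (map env s ++ map env s').
Proof. by move=> sq s'd; rewrite -map_cat; apply: holds_rel; rewrite size_cat sq s'd. Qed.

Lemma holds_static :
  eholds (QBig (static_clauses (@QImp sg W) (relF (A := A)) (zeroF sg N (A := A))
    (succF sg N (A := A)) t p p') id) =
  all id (static_clauses implb relB (zeroB e) (succB e) (map env t) (map env p) (map env p')).
Proof.
rewrite all_holds /= !holds_imp !holds_rel2 // !holds_rel1 // !holds_zero.
by rewrite holds_succ ?pd.
Qed.

Lemma holds_pos (i : 'I_nb) a a' : size a = q i -> size a' = q i ->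
  eholds (QBig (pos_clauses (QTrue sg W) (@QImp sg W) (@QNot sg W) (relF (A := A))
    (zeroF sg N (A := A)) (lastF sg N (A := A)) (succF sg N (A := A))
    (fun i => bitF N (nth_block i)) i a a' t p p') id) =
  all id (pos_clauses true implb negb relB (zeroB e) (lastB e) (succB e)
    (fun i => bitB (nth_block i)) i (map env a) (map env a') (map env t) (map env p) (map env p')).
Proof.
move=> ai a'i; have qiA : q i <= A.+1 by apply: leq_trans (qA i); apply: leq_addr.
rewrite all_holds /= !holds_guard !holds_imp !holds_not.
rewrite !(holds_relq (i := i) _ ai) // !(holds_relq (i := i) _ a'i) //.
rewrite !holds_rel2 // !holds_rel1 // !holds_zero !holds_last holds_bit //.
by rewrite !holds_succ ?pd ?ai.
Qed.

Lemma holds_next (i j : 'I_nb) a a' : size a = q i -> size a' = q j ->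
  eholds (next_clause (QTrue sg W) (@QImp sg W) (relF (A := A))
    (zeroF sg N (A := A)) (lastF sg N (A := A)) (succF sg N (A := A)) i j a a' p p') =
  next_clause true implb relB (zeroB e) (lastB e) (succB e)
    i j (map env a) (map env a') (map env p) (map env p').
Proof.
move=> ai a'j; rewrite /next_clause holds_guard !holds_imp.
rewrite !(holds_relq (i := i) _ ai) // !(holds_relq (i := j) _ a'j) //.
by rewrite holds_zero holds_last holds_succ ?pd.
Qed.

Lemma holds_choice q b :
  eholds (choice_clause (QTrue sg W) (@QImp sg W) (fun I => @QEx sg W I) (relF (A := A)) q b t p) =
  choice_clause true implb (fun I xs f => has f xs) relB q b (map env t) (map env p).
Proof.
rewrite /choice_clause holds_guard !holds_imp !holds_rel2 // !holds_rel1 // holds_ex.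
congr (if _ then _ ==> _ ==> _ ==> _ else _).
by apply: eq_has => l; apply: holds_rel1.
Qed.

Lemma holds_trans l b :
  eholds (QBig (trans_clauses (QTrue sg W) (@QImp sg W) (@QNot sg W) (relF (A := A))
    (zeroF sg N (A := A)) (succF sg N (A := A)) (sameF sg N (A := A)) l b t t' p p') id) =
  all id (trans_clauses true implb negb relB (zeroB e) (succB e) sameB l b
    (map env t) (map env t') (map env p) (map env p')).
Proof.
rewrite all_holds /= !holds_guard !holds_imp !holds_not.
rewrite !holds_rel2 // !holds_rel1 // !holds_zero !holds_same ?pd //.
by rewrite !holds_succ ?pd ?td.
Qed.

End Lists.

Let dA' : d <= A.+1. Proof. exact: leq_trans (leq_addr _ _) dA. Qed.

Lemma holds_fagin : eholds (fagin sg k N d A) <-> eholds (order_axioms sg N A) /\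
  run_clauses e (map env (vars A (inord 0) d)) (map env (vars A (inord 1) d))
    (map env (vars A (inord 2) d)) (map env (vars A (inord 3) d))
    (fun i => map env (vars A (inord 4) (q i))) (fun i => map env (vars A (inord 5) (q i))).
Proof.
have qA' (i : 'I_nb) : q i <= A.+1 by apply: leq_trans (qA i); apply: leq_addr.
have -> : eholds (fagin sg k N d A) = [&& eholds (order_axioms sg N A),
    eholds (static_formula sg N d A), eholds (pos_formula sg k N d A),
    eholds (next_formula sg k N d A), eholds (choice_formula sg N d A) &
    eholds (trans_formula sg N d A)] by [].
rewrite holds_static ?size_vars // /pos_formula /next_formula.
rewrite /choice_formula /trans_formula !(holds_big _ (enum _)); split.
  case/andP=> -> /and5P[st /allP po /allP ne /allP ch /allP tr].
  split=> //; split=> //.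
  - by move=> i; rewrite -holds_pos ?size_vars //; apply: po; rewrite mem_enum.
  - by move=> i j; rewrite -holds_next ?size_vars //; apply: (ne (i, j)); rewrite mem_enum.
  - by move=> c b; rewrite -holds_choice ?size_vars //; apply: (ch (c, b)); rewrite mem_enum.
  - by move=> l b; rewrite -holds_trans ?size_vars //; apply: (tr (l, b)); rewrite mem_enum.
case=> -> [-> po ne ch tr]; apply/andP; split=> //.
apply/and5P; split=> //; apply/allP.
- by move=> i _; rewrite holds_pos ?size_vars.
- by move=> [i j] _; rewrite holds_next ?size_vars //; apply: ne.
- by move=> [c b] _; rewrite holds_choice ?size_vars //; apply: ch.
- by move=> [l b] _; rewrite holds_trans ?size_vars //; apply: tr.
Qed.

End Env.
End Semantics.

Local Arguments holds : simpl never.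

(** * The enumeration determined by the guessed order *)

Section Order.
Variables (sg : signature) (N : ntm) (A : nat) (M : finModel sg).
Variable F : sym sg N -> seq M -> M.
Local Notation U := ('I_6 * 'I_A.+1)%type.
Local Notation ltF x y := (relB F (SLt _ _) [:: x; y]).

Definition order_clauses (x y z : M) :=
  [/\ ~~ ltF x x, ltF x y -> ltF y z -> ltF x z,
      [|| x == y, ltF x y | ltF y x], z = F (SZero _ _) [::] -> (x == z) || ltF z x &
      z = F (SLast _ _) [::] -> (x == z) || ltF x z] /\
  (ltF x y -> z = F (SSucc _ _) [:: x] -> ltF x z && ((z == y) || ltF z y)).

Lemma holds_order (env : U -> M) : 0 < A ->
  holds (wval F env) (order_axioms sg N A) <->
  order_clauses (env (inord 0, ord0)) (env (inord 1, ord0)) (env (inord 2, ord0)).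
Proof.
move=> A0; rewrite /order_axioms; set x := (inord 0, _); set y := (inord 1, _).
set z := (inord 2, _); cbv zeta.
have lt u v : holds (wval F env) (relF (SLt sg N) [:: u; v]) = ltF (env u) (env v).
  by rewrite holds_rel.
have eqE u v : holds (wval F env) (QEq sg (inl u) (inl v)) = (env u == env v) by [].
have fE u g vs : size vs <= A.+1 ->
    holds (wval F env) (QEq sg (inl u) (fapp g vs)) = (env u == F g (map env vs)).
  by move=> vA; rewrite -[LHS]/(env u == wval F env (fapp g vs)) wval_fapp.
rewrite all_holds [map _ _]/= !holds_or !holds_imp !holds_and !holds_imp.
rewrite !holds_not !lt !fE // !eqE /=; split.
  case/and5P=> h1 /implyP h2 h3 /implyP h4 /and3P[/implyP h5 /implyP h6 _].
  split; first split=> //.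
  - by move=> xy; apply/implyP/h2.
  - by move=> zE; rewrite -implyNb h4 ?zE.
  - by move=> zE; rewrite -implyNb h5 ?zE.
  - move=> xy zE; have := h6 xy; rewrite zE eqxx /= -zE => /andP[-> h].
    by rewrite -implyNb.
case=> -[h1 h2 h3 h4 h5] h6; rewrite h1 h3 /=; apply/and5P; split=> //.
- by apply/implyP=> xy; apply/implyP/h2.
- by apply/implyP=> /eqP zE; rewrite implyNb h4.
- by apply/implyP=> /eqP zE; rewrite implyNb h5.
- by apply/implyP=> xy; apply/implyP=> /eqP zE; rewrite implyNb h6.
Qed.

(** Sorting the domain by the guessed order gives [e]; comparing indices in [e] is then the order
    itself. *)
Lemma order_exists : (forall x y z, order_clauses x y z) -> exists e, order_ok F e.
Proof.
move=> H; pose le x y := (x == y) || ltF x y.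
have lt_irr x : ~~ ltF x x by case: (H x x x) => -[].
have lt_tr x y z : ltF x y -> ltF y z -> ltF x z by case: (H x y z) => -[].
have lt_tot x y : [|| x == y, ltF x y | ltF y x] by case: (H x y y) => -[].
have zero_min x : (x == F (SZero _ _) [::]) || ltF (F (SZero _ _) [::]) x.
  by case: (H x x (F (SZero _ _) [::])) => -[_ _ _ + _] _; apply.
have last_max x : (x == F (SLast _ _) [::]) || ltF x (F (SLast _ _) [::]).
  by case: (H x x (F (SLast _ _) [::])) => -[_ _ _ _ + _]; apply.
have succ_next x y : ltF x y -> ltF x (F (SSucc _ _) [:: x]) &&
    ((F (SSucc _ _) [:: x] == y) || ltF (F (SSucc _ _) [:: x]) y).
  by move=> xy; case: (H x y (F (SSucc _ _) [:: x])) => _ +; apply.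
have le_tr : transitive le.
  move=> y x z /orP[/eqP -> //|xy] /orP[/eqP <-|yz]; first by rewrite /le xy orbT.
  by rewrite /le (lt_tr _ _ _ xy yz) orbT.
have le_tot : total le.
  by move=> x y; case/or3P: (lt_tot x y) => h; rewrite /le h ?orbT // eq_sym.
pose e := sort le (enum M).
have eu : uniq e by rewrite sort_uniq enum_uniq.
have ea : e =i predT by move=> x; rewrite mem_sort mem_enum.
have ltE x y : ltF x y = (index x e < index y e).
  have idx_lt u w : index u e < index w e -> ltF u w.
    move=> uw; have := sorted_ltn_index le_tr (sort_sorted le_tot (enum M)).
    move=> /(_ u w (ea u) (ea w) uw) /orP[/eqP uw'|//].
    by rewrite uw' ltnn in uw.
  case: (ltngtP (index x e) (index y e)) => [/idx_lt -> //|/idx_lt yx|/(index_all_inj ea) ->].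
    by apply/negbTE/negP => /lt_tr/(_ yx); apply/negP.
  exact/negbTE.
have /card_gt0P[m0 _] := ltnW (dom_gt1 M).
have nth_idx i : i < size e -> index (nth m0 e i) e = i by move=> ie; rewrite index_uniq.
have idxE x y : (x == y) = (index x e == index y e).
  by apply/eqP/eqP => [->|/(index_all_inj ea)].
have lt_size x : index x e < size e := index_lt ea x.
have e0 : 0 < size e := leq_ltn_trans (leq0n _) (lt_size m0).
exists e; split=> //.
- move=> x; have := zero_min (nth m0 e 0).
  rewrite ltE idxE nth_idx // ltn0 orbF => /eqP E.
  by rewrite idxE -E.
- move=> x; have := last_max (nth m0 e (size e).-1).
  have := lt_size (F (SLast _ _) [::]); have := lt_size x.
  rewrite ltE !idxE nth_idx; last by rewrite prednK.
  move: (index _ e) (index x e) => i j ji ii /orP H1.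
  have -> : i = (size e).-1 by case: H1 => [/eqP|]; lia.
  by rewrite -(eqn_add2r 1) !addn1 prednK.
- move=> x y; apply/andP/eqP => [[xy /eqP sy]|yx].
    have xe : (index x e).+1 < size e.
      by apply: leq_ltn_trans (lt_size y); rewrite -ltE.
    (* The entry after [x] in [e] is above [x], so the least element above [x], which is [y], does
       not come later. *)
    have : ltF x (nth m0 e (index x e).+1) by rewrite ltE nth_idx.
    move=> /succ_next /andP[_]; rewrite sy ltE idxE nth_idx // -leq_eqVlt.
    by move: xy; rewrite ltE; lia.
  have xy : ltF x y by rewrite ltE yx.
  split=> //; have /andP[] := succ_next _ _ xy.
  by rewrite !ltE !idxE yx => h /orP[//|]; rewrite ltnS leqNgt h.
Qed.

End Order.

(** * Passing between environments and tuples *)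

Section Runs.
Variables (sg : signature) (k : nat) (N : ntm) (d A : nat).
Local Notation tsym := (option (bool + ntm_work N)).
Local Notation nb := (size (blocks sg)).
Local Notation sym := (sym sg N).
Local Notation U := ('I_6 * 'I_A.+1)%type.
Local Notation q i := (barity k (nth_block i)).
Hypothesis A_gt0 : 0 < A.
Hypothesis dA : d + d <= A.+1.
Hypothesis qA : forall i : 'I_nb, q i + d <= A.+1.
Variables (M : finModel sg) (R : set (k.-tuple M)) (F : sym -> seq M -> M).
Hypothesis RF : forall a : k.-tuple M, R a <-> F (STeam _ _) a = F (SZero _ _) [::].

Record run_ok (e : seq M) : Prop := RunOk {
  run_static : forall t p p', size t = d -> size p = d -> size p' = d ->
    all id (static_clauses implb (relB F) (zeroB e) (succB e) t p p');
  run_pos : forall (i : 'I_nb) a a' t p p', size a = q i -> size a' = q i ->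
    size t = d -> size p = d -> size p' = d ->
    all id (pos_clauses true implb negb (relB F) (zeroB e) (lastB e) (succB e)
      (fun i => bitB R (nth_block i)) i a a' t p p');
  run_next : forall (i j : 'I_nb) a a' p p', size a = q i -> size a' = q j ->
    size p = d -> size p' = d ->
    next_clause true implb (relB F) (zeroB e) (lastB e) (succB e) i j a a' p p';
  run_choice : forall c b t p, size t = d -> size p = d ->
    choice_clause true implb (fun I xs f => has f xs) (relB F) c b t p;
  run_trans : forall l b t t' p p', size t = d -> size t' = d ->
    size p = d -> size p' = d ->
    all id (trans_clauses true implb negb (relB F) (zeroB e) (succB e) (@sameB sg M)
      l b t t' p p') }.

(** The groups of variables are disjoint, so their values can be prescribed separately; shorter
    lists are padded with [m0]. *)
Lemma env_of_lists (ls : seq (seq M)) : (forall i, size (nth [::] ls i) <= A.+1) ->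
  exists env : U -> M, forall i r, i < 6 -> size (nth [::] ls i) = r ->
    map env (vars A (inord i) r) = nth [::] ls i.
Proof.
move=> lsA; have /card_gt0P[m0 _] := ltnW (dom_gt1 M).
exists (fun bi : U => nth m0 (nth [::] ls bi.1) bi.2) => i _ i6 <-.
set l := nth [::] ls i; rewrite /vars -map_comp /comp /= inordK // -/l.
rewrite (map_comp (nth m0 l) (@nat_of_ord A.+1)) map_take val_enum_ord take_iota.
by rewrite (minn_idPl (lsA i)) map_nth_iota0 // take_size.
Qed.

Lemma fagin_runs : (forall env, holds (wval F env) (fagin sg k N d A)) ->
  exists2 e, order_ok F e & run_ok e.
Proof.
move=> H; have dA' : d <= A.+1 by apply: leq_trans dA; apply: leq_addr.
have qA' (i : 'I_nb) : q i <= A.+1 by apply: leq_trans (qA i); apply: leq_addr.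
have [e eF] : exists e, order_ok F e.
  apply: order_exists => x y z.
  have [|env envE] := env_of_lists (ls := [:: [:: x]; [:: y]; [:: z]]).
    by case=> [|[|[|[|i]]]].
  have /andP[/(holds_order _ _ A_gt0) + _] := H env.
  have var1 i : [:: (inord i, ord0)] = vars A (inord i) 1 by rewrite /vars enum_ordSl /= take0.
  have := envE 0 1 isT erefl; have := envE 1 1 isT erefl; have := envE 2 1 isT erefl.
  by rewrite -!var1 /= => -[->] [->] [->].
exists e => //.
(* All blocks share the last two groups of variables, so entries can be prescribed for only two
   blocks at a time; no clause needs more. *)
have get t t' p p' a a' (i j : 'I_nb) : size t = d -> size t' = d -> size p = d ->
    size p' = d -> size a = q i -> size a' = q j -> exists env : U -> M,
    run_clauses R F e t t' p p'
      (fun i => map env (vars A (inord 4) (q i))) (fun i => map env (vars A (inord 5) (q i))) /\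
    map env (vars A (inord 4) (q i)) = a /\ map env (vars A (inord 5) (q j)) = a'.
  move=> td t'd pd p'd ai a'j.
  have [|env envE] := env_of_lists (ls := [:: t; t'; p; p'; a; a']).
    by case=> [|[|[|[|[|[|i0]]]]]] //=; rewrite ?td ?t'd ?pd ?p'd ?ai ?a'j ?nth_nil.
  have [+ _] := holds_fagin A_gt0 dA qA env RF eF; move=> /(_ (H env)) [_].
  rewrite (envE 0) // (envE 1) // (envE 2) // (envE 3) //= => run.
  by exists env; split=> //; rewrite (envE 4) // (envE 5).
have i0 : 'I_nb by exists 0.
have ex (i : 'I_nb) : exists a : seq M, size a = q i.
  have /card_gt0P[m0 _] := ltnW (dom_gt1 M).
  by exists (nseq (q i) m0); rewrite size_nseq.
have [a0 a0i] := ex i0.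
split.
- by move=> t p p' td pd p'd; have [env [[]]] := get t t p p' a0 a0 i0 i0 td td pd p'd a0i a0i.
- move=> i a a' t p p' ai a'i td pd p'd.
  have [env [[_ + _ _ _] [Ea Ea']]] := get t t p p' a a' i i td td pd p'd ai a'i.
  by move=> /(_ i); rewrite /= Ea Ea'.
- move=> i j a a' p p' ai a'j pd p'd.
  have [env [[_ _ + _ _] [Ea Ea']]] := get p p p p' a a' i j pd pd pd p'd ai a'j.
  by move=> /(_ i j); rewrite /= Ea Ea'.
- move=> c b t p td pd.
  by have [env [[_ _ _ + _] _]] := get t t p p a0 a0 i0 i0 td td pd pd a0i a0i; apply.
- move=> l b t t' p p' td t'd pd p'd.
  by have [env [[_ _ _ _ +] _]] := get t t' p p' a0 a0 i0 i0 td t'd pd p'd a0i a0i; apply.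
Qed.

Lemma runs_fagin e : order_ok F e -> (forall x y z, order_clauses F x y z) ->
  run_ok e -> forall env, holds (wval F env) (fagin sg k N d A).
Proof.
move=> eF ord [st po ne ch tr] env.
have dA' : d <= A.+1 by apply: leq_trans dA; apply: leq_addr.
have qA' (i : 'I_nb) : q i <= A.+1 by apply: leq_trans (qA i); apply: leq_addr.
apply/(holds_fagin A_gt0 dA qA env RF eF); split.
- exact/holds_order.
- split=> [|i|i j|c b|l b]; [apply: st|apply: po|apply: ne|apply: ch|apply: tr];
    by rewrite size_map size_vars.
Qed.

End Runs.

(** * From the formula to an accepting run *)

Section Positions.
Variables (sg : signature) (k : nat) (M : finModel sg) (R : set (k.-tuple M)) (e : seq M).
Hypotheses (e_uniq : uniq e) (e_all : e =i predT).
Local Notation nb := (size (blocks sg)).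
Local Notation q i := (barity k (nth_block i)).

Definition offset (i : nat) := sumn (take i (bsizes sg k (size e))).

Lemma offsetS (i : 'I_nb) : offset i.+1 = offset i + size e ^ q i.
Proof.
rewrite /offset (take_nth 0) ?size_map // sumn_rcons; congr (_ + _).
by rewrite (nth_map (BDom sg)).
Qed.

Lemma offset_end : offset nb = size (encode R e).
Proof.
rewrite size_encode // -(size_enumeration e_uniq e_all) /offset.
by rewrite -(size_map (fun b => size e ^ barity k b)) take_size.
Qed.

Lemma enum_gt0 : 0 < size e.
Proof. by rewrite (size_enumeration e_uniq e_all) ltnW // dom_gt1. Qed.

Lemma offset_le (i : 'I_nb) : offset i + size e ^ q i <= size (encode R e).
Proof.
rewrite -offsetS size_encode // -(size_enumeration e_uniq e_all) /offset.
set s := bsizes _ _ _; rewrite -[s in leqRHS](cat_take_drop i.+1) sumn_cat.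
exact: leq_addr.
Qed.

Lemma offset_split m : m < size (encode R e) -> exists (i : 'I_nb) a,
  size a = q i /\ m = offset i + lrank e a.
Proof.
rewrite size_encode // -(size_enumeration e_uniq e_all) => mw.
have im := reshape_indexP mw; have jm := reshape_offsetP mw.
have Em := reshape_indexK (bsizes sg k (size e)) m.
rewrite size_map in im.
have [i Ei] : exists i : 'I_nb, i = reshape_index (bsizes sg k (size e)) m :> nat.
  by exists (Ordinal im).
rewrite -Ei in jm Em; rewrite (nth_map (BDom sg)) // in jm.
have [a ai aj] := lrank_surj e_uniq jm.
by exists i, a; rewrite ai aj; split=> //; rewrite -Em.
Qed.

Lemma nth_encode_bit (i : 'I_nb) a : size a = q i ->
  nth false (encode R e) (offset i + lrank e a) = bitB R (nth_block i) a.
Proof.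
move=> /eqP ai; rewrite -[a]/(tval (Tuple ai)) bitB_tuple.
exact: (nth_encode R e_uniq e_all (Tuple ai)).
Qed.

End Positions.

Section Sound.
Variables (sg : signature) (k : nat) (N : ntm) (d : nat).
Local Notation nb := (size (blocks sg)).
Local Notation sym := (sym sg N).
Local Notation q i := (barity k (nth_block i)).
Variables (M : finModel sg) (R : set (k.-tuple M)) (F : sym -> seq M -> M) (e : seq M).
Hypotheses (e_uniq : uniq e) (e_all : e =i predT) (run : run_ok d R F e).
Local Notation w := (encode R e).
Local Notation rk := (lrank e).
Local Notation rel := (relB F).

Lemma rk_pred p m : size p = d -> rk p = m.+1 -> exists2 p', size p' = d & rk p' = m.
Proof.
move=> pd pm; apply: lrank_surj => //; apply: ltnW.
by rewrite -pm -pd lrank_lt.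
Qed.

Lemma last_exists (i : 'I_nb) : exists2 a, size a = q i & (rk a).+1 = size e ^ q i.
Proof.
have e0 : 0 < size e ^ q i by rewrite expn_gt0 enum_gt0.
have [|a ai aj] := @lrank_surj _ _ e_uniq (q i) (size e ^ q i).-1; first by rewrite prednK.
by exists a => //; rewrite aj prednK.
Qed.

(** Induction on the position rather than within a block, since the predecessor of a first entry is
    the last entry of the preceding block. *)
Lemma pos_rel (i : 'I_nb) a p : size a = q i -> size p = d ->
  rk p = offset k e i + rk a -> rel (SPos _ i) (a ++ p).
Proof.
move: {2}(rk p) (erefl (rk p)) => m; elim: m i a p => [|m IH] i a p pm ai pd.
  rewrite pm => /esym/eqP; rewrite addn_eq0 => /andP[oi /eqP a0].
  have i0 : i = 0 :> nat.
    case: (nat_of_ord i) (ltn_ord i) oi => // i' i'nb.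
    have /= := offsetS k e (Ordinal (ltnW i'nb)) => ->.
    by rewrite addn_eq0 expn_eq0 [size e == 0]eqn0Ngt enum_gt0 // andbF.
  have /and5P[+ _ _ _ _] := run_pos run ai ai pd pd pd.
  by rewrite i0 eqxx /zeroB a0 pm.
have [p' p'd p'm] := rk_pred pd pm.
case am : (rk a) => [|r].
  rewrite addn0 pm => im; case Ei : (nat_of_ord i) => [|i']; first by rewrite Ei in im.
  have i'nb : i' < nb by rewrite ltnW // -Ei.
  pose j := Ordinal i'nb; have [a' a'j a'last] := last_exists j.
  have ra' : rk p' = offset k e j + rk a'.
    by apply: succn_inj; rewrite p'm im Ei -addnS a'last -offsetS.
  have := run_next run a'j ai p'd pd; rewrite /next_clause Ei eqxx.
  rewrite (IH j a' p') // /lastB a'j a'last eqxx /zeroB am /succB pm p'm !eqxx.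
  exact.
have ai' : r < size e ^ q i.
  by apply: ltnW; rewrite -am -ai lrank_lt.
have [a' a'i a'r] := lrank_surj e_uniq ai'.
rewrite pm addnS => -[mr].
have /and5P[_ + _ _ _] := run_pos run a'i ai pd p'd pd.
by rewrite (IH i a' p') // ?p'm ?a'r // /succB am a'r pm p'm !eqxx.
Qed.

Lemma blank_rel p : size p = d -> size w <= rk p -> rel (SBlank _ _) p.
Proof.
move: {2}(rk p) (erefl (rk p)) => m; elim: m p => [|m IH] p pm pd wp.
  have i0 : 0 < nb by [].
  have := offset_le R e_uniq e_all (Ordinal i0); move: wp; rewrite pm leqn0 => /eqP ->.
  by rewrite leqn0 addn_eq0 expn_eq0 [size e == 0]eqn0Ngt enum_gt0 // andbF.
have [p' p'd p'm] := rk_pred pd pm.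
case: (ltngtP (size w) (rk p)) wp => // wp _.
  have /andP[+ _] := run_static run pd p'd pd.
  rewrite (IH p') // /succB ?pm p'm ?eqxx //; by rewrite pm in wp.
(* The position just behind the code follows the last entry of the last block. *)
have nb0 : nb.-1 < nb by [].
pose i := Ordinal nb0; have [a ai alast] := last_exists i.
have ra : rel (SPos _ i) (a ++ p').
  apply: pos_rel => //; apply: succn_inj.
  by rewrite -addnS alast -offsetS p'm -pm -wp -(offset_end _ e_uniq e_all).
have /and5P[_ _ + _ _] := run_pos run ai ai pd p'd pd.
by rewrite ra prednK // eqxx /lastB ai alast eqxx /succB pm p'm !eqxx.
Qed.

Lemma cell_rel t p : size t = d -> size p = d -> rk t = 0 ->
  rel (SCell _ (nth None [seq Some (inl b) | b <- w] (rk p))) (t ++ p).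
Proof.
move=> td pd t0; case: (ltnP (rk p) (size w)) => wp.
  have [i [a [ai pE]]] := offset_split e_uniq e_all wp.
  rewrite (nth_map false) // pE nth_encode_bit //.
  have /and5P[_ _ _ c1 /andP[c0 _]] := run_pos run ai ai td pd pd.
  move: c1 c0; rewrite pos_rel // /zeroB t0 eqxx /=.
  by case: (bitB _ _ _).
rewrite nth_default ?size_map //.
have /and3P[_ + _] := run_static run td pd pd.
by rewrite blank_rel // /zeroB t0.
Qed.

Lemma steps_rcons j (c c' c'' : config N) : steps j c c' -> step c' c'' -> steps j.+1 c c''.
Proof.
elim: j c => [|j IH] c /= => [-> s|[c1 s1 s] s']; first by exists c''.
by exists c1 => //; apply: IH s s'.
Qed.

(** One direction only: the tables contain the facts about [c] and possibly others. *)
Definition follows j (c : config N) := forall t, size t = d -> rk t = j ->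
  [/\ rel (SState _ (cstate c)) t,
      forall p, size p = d -> rk p = chead c -> rel (SHead _ _) (t ++ p) &
      forall p, size p = d -> rel (SCell _ (ctape c (rk p))) (t ++ p)].

(* If the machine does not accept, its run reaches length n^d - 1. *)
Lemma run_follows j : j < size e ^ d -> accepts N w \/
  exists c, [/\ steps j (init_config N w) c, chead c <= j & follows j c].
Proof.
elim: j => [|j IH] jd.
  right; exists (init_config N w); split=> // t td t0.
  have /and4P[_ _ c1 /andP[c2 _]] := run_static run td td td.
  split; first by move: c1; rewrite /zeroB t0.
    move=> p pd p0; have /and4P[_ _ _ /andP[+ _]] := run_static run td pd pd.
    by rewrite /zeroB t0 p0.
  by move=> p pd; apply: cell_rel.
case: (IH (ltnW jd)) => [|[c [sc hc fc]]]; first by left.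
case: (boolP (ntm_accept (cstate c))) => [acc|nacc]; first by left; exists j, c.
have [t td tj] := lrank_surj e_uniq (ltnW jd).
(* The head is within the first [j.+1] cells, so its cell is numbered by a [d]-tuple too. *)
have [p pd pc] := lrank_surj e_uniq (leq_ltn_trans hc (ltnW jd)).
have [c1 c2 c3] := fc t td tj.
(* Any label found in the table at [t] can serve as the next transition, even if there are
   several. *)
have := run_choice run (cstate c) (ctape c (chead c)) td pd.
rewrite /choice_clause nacc c1 (c2 p) // -pc (c3 p) //= => /hasP[l].
rewrite mem_filter pc => /andP[dl _] rl.
right; pose c' := Config l.1.1 (fun i => if i == chead c then l.1.2 else ctape c i)
  (if l.2 then (chead c).+1 else (chead c).-1).
exists c'; split.
- apply: steps_rcons sc _; exists l.1.1, l.1.2, (if l.2 then MoveR else MoveL).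
  by rewrite -surjective_pairing; split=> //; rewrite /c'; case: l.2.
- by rewrite /=; case: l.2; lia.
move=> t' t'd t'j.
have St : succB e t t' by rewrite /succB tj t'j.
split.
- have /and5P[+ _ _ _ _] := run_trans run l None td t'd pd pd.
  by rewrite rl St.
- move=> p' p'd.
  rewrite -[chead c']/(if l.2 then (chead c).+1 else (chead c).-1) => p'c.
  have /and5P[_ _ _ c4 /and3P[c5 c6 _]] := run_trans run l None td t'd pd p'd.
  move: c4 c5 c6 p'c; rewrite rl St (c2 p) //= /succB /zeroB pc.
  case: l.2 => /=; first by move=> h _ _ E; move: h; rewrite E eqxx.
  move=> _; case cE: (chead c) => [|h] /= h1 h2 E; last by move: h1; rewrite E eqxx.
  by rewrite (lrank_inj e_uniq e_all (_ : size p' = size p)) ?p'd ?pd ?pc ?cE.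
- move=> p' p'd /=; case: eqP => [p'c|p'c].
    have -> : p' = p by apply: (lrank_inj e_uniq e_all); rewrite ?p'd ?p'c.
    have /and5P[_ + _ _ _] := run_trans run l None td t'd pd pd.
    by rewrite rl St (c2 p).
  have /and5P[_ _ + _ _] := run_trans run l (ctape c (rk p')) td t'd pd p'd.
  rewrite rl St (c2 p) // (c3 p') // /sameB.
  case: eqP => [pp'|_]; last exact.
  by rewrite -pp' pc in p'c.
Qed.

(** Without acceptance the tables would yield a run of [(T (size w)).+1] steps. *)
Lemma runs_accept T : runs_in_time N T -> (T (size w)).+1 < size e ^ d -> accepts N w.
Proof.
move=> NT Td; case: (run_follows Td) => // -[c [sc _ _]].
by have := NT _ _ _ sc; rewrite ltnn.
Qed.

End Sound.

(** * From an accepting run to the formula *)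

Section Complete.
Variables (sg : signature) (k : nat) (N : ntm) (d : nat).
Local Notation nb := (size (blocks sg)).
Local Notation sym := (sym sg N).
Local Notation q i := (barity k (nth_block i)).
Variables (M : finModel sg) (R : set (k.-tuple M)) (e : seq M) (m0 : M).
Hypotheses (e_uniq : uniq e) (e_all : e =i predT).
Local Notation w := (encode R e).
Local Notation rk := (lrank e).
Variables (cs : nat -> config N) (t0 : nat).
Hypotheses (cs0 : cs 0 = init_config N w).
Hypothesis cs_step : forall i, i < t0 -> step (cs i) (cs i.+1).
Hypothesis cs_accept : ntm_accept (cstate (cs t0)).

Definition transition (c c' : config N) (l : trans_label N) : Prop :=
  ntm_delta (cstate c) (ctape c (chead c)) (l.1, if l.2 then MoveR else MoveL) /\
  c' = Config l.1.1 (fun i => if i == chead c then l.1.2 else ctape c i)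
         (if l.2 then (chead c).+1 else (chead c).-1).

Lemma step_transition c c' : step c c' -> exists l, transition c c' l.
Proof.
by case=> s [a [[] [H ->]]]; [exists (s, a, false)|exists (s, a, true)].
Qed.

(** The tables for the run stop at the accepting time [t0]; clauses about later times hold
    vacuously. *)
Definition history_rel (g : sym) (l : seq M) : bool :=
  match g with
  | SLt => index (nth m0 l 0) e < index (nth m0 l 1) e
  | STeam => `[< exists2 a : k.-tuple M, R a & l = a >]
  | SPos i => rk (drop (q i) l) == offset k e i + rk (take (q i) l)
  | SBlank => size w <= rk l
  | SState s => (rk l <= t0) && (cstate (cs (rk l)) == s)
  | SHead => (rk (take d l) <= t0) && (chead (cs (rk (take d l))) == rk (drop d l))
  | SCell a => (rk (take d l) <= t0) && (ctape (cs (rk (take d l))) (rk (drop d l)) == a)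
  | STrans b => (rk l < t0) && `[< transition (cs (rk l)) (cs (rk l).+1) b >]
  | SZero | SLast | SSucc => true
  end.

(** The first entry of [e] encodes truth and the second falsity. [SSucc] falls back on [m0] at the
    last element. *)
Definition history (g : sym) (l : seq M) : M :=
  match g with
  | SZero => nth m0 e 0
  | SLast => nth m0 e (size e).-1
  | SSucc => nth m0 e (index (nth m0 l 0) e).+1
  | _ => nth m0 e (~~ history_rel g l)
  end.

Lemma enum_gt1 : 1 < size e.
Proof. by rewrite (size_enumeration e_uniq e_all) dom_gt1. Qed.

Lemma nth_bool_eq0 (b : bool) : (nth m0 e (~~ b) == nth m0 e 0) = b.
Proof. by have e1 := enum_gt1; rewrite nth_uniq //; case: b => //; apply: ltnW. Qed.

Local Notation rel := (relB history).

Lemma rel_lt x y : rel (SLt _ _) [:: x; y] = (index x e < index y e).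
Proof. exact: nth_bool_eq0. Qed.
Lemma rel_pos i a p : size a = q i ->
  rel (SPos _ i) (a ++ p) = (rk p == offset k e i + rk a).
Proof. by move=> ai; rewrite [LHS]nth_bool_eq0 /= -ai drop_size_cat // take_size_cat. Qed.
Lemma rel_blank p : rel (SBlank _ _) p = (size w <= rk p).
Proof. exact: nth_bool_eq0. Qed.
Lemma rel_state s t : rel (SState _ s) t = (rk t <= t0) && (cstate (cs (rk t)) == s).
Proof. exact: nth_bool_eq0. Qed.
Lemma rel_head t p : size t = d ->
  rel (SHead _ _) (t ++ p) = (rk t <= t0) && (chead (cs (rk t)) == rk p).
Proof. by move=> td; rewrite [LHS]nth_bool_eq0 /= -td drop_size_cat // take_size_cat. Qed.
Lemma rel_cell a t p : size t = d ->
  rel (SCell _ a) (t ++ p) = (rk t <= t0) && (ctape (cs (rk t)) (rk p) == a).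
Proof. by move=> td; rewrite [LHS]nth_bool_eq0 /= -td drop_size_cat // take_size_cat. Qed.
Lemma rel_trans l t : rel (STrans _ l) t =
  (rk t < t0) && `[< transition (cs (rk t)) (cs (rk t).+1) l >].
Proof. exact: nth_bool_eq0. Qed.

Lemma history_team (a : k.-tuple M) :
  R a <-> history (STeam _ _) a = history (SZero _ _) [::].
Proof.
have -> : (history (STeam _ _) a = history (SZero _ _) [::]) <->
    (rel (STeam _ _) a : Prop) by split=> /eqP.
rewrite [rel _ _]nth_bool_eq0 /=; split=> [Ra|/asboolP[a' Ra' /val_inj -> //]].
by apply/asboolP; exists a.
Qed.

Lemma history_order : order_ok history e.
Proof.
have e0 := ltnW enum_gt1.
have idxE x i : i < size e -> (x == nth m0 e i) = (index x e == i).
  move=> ie; apply/eqP/eqP => [->|<-]; first by rewrite index_uniq.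
  by rewrite nth_index ?e_all.
split=> // x; rewrite /history; first by rewrite idxE.
  by rewrite idxE ?prednK // -eqSS prednK.
move=> y; rewrite rel_lt /= eq_sym.
case: (ltnP (index x e).+1 (size e)) => xe.
  by rewrite idxE // andb_idl // => /eqP ->.
rewrite ltnNge -ltnS (leq_trans (index_lt e_all y)) //=.
by apply/esym/eqP => E; have := index_lt e_all y; rewrite E ltnNge xe.
Qed.

Lemma history_order_clauses x y z : order_clauses history x y z.
Proof.
have eqE u v : (u == v) = (index u e == index v e).
  by apply/eqP/eqP => [->|/(index_all_inj e_all)].
have [_ _ eF0 eFl eFs] := history_order.
split; first split; rewrite ?rel_lt ?eqE.
- by rewrite ltnn.
- exact: ltn_trans.
- by case: ltngtP.
- by move=> /eqP; rewrite eF0 => /eqP ->; rewrite lt0n orbN.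
- move=> /eqP; rewrite eFl => /eqP E; have := index_lt e_all x.
  by rewrite -E ltnS leq_eqVlt.
move=> xy zE; have Ez : index z e = (index x e).+1.
  rewrite zE /= index_uniq //; exact: leq_ltn_trans xy (index_lt e_all y).
by rewrite Ez ltnSn -leq_eqVlt.
Qed.

Lemma history_runs : run_ok d R history e.
Proof.
split.
- move=> t p p' td pd p'd; apply/and5P; split=> //; rewrite ?rel_blank /succB /zeroB.
  + by apply/implyP=> wp; apply/implyP=> /eqP ->; apply: leqW.
  + apply/implyP=> wp; apply/implyP=> /eqP tz; rewrite rel_cell // tz cs0 /=.
    by rewrite nth_default ?size_map.
  + by apply/implyP=> /eqP tz; rewrite rel_state tz cs0 /=.
  + apply/implyP=> /eqP tz; apply/implyP=> /eqP pz.
    by rewrite rel_head // tz cs0 pz.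
- move=> i a a' t p p' ai a'i td pd p'd.
  have wa : offset k e i + rk a < size w.
    apply: leq_trans (offset_le R e_uniq e_all i).
    by rewrite ltn_add2l -ai lrank_lt.
  have cell : nth None [seq Some (inl b) | b <- w] (offset k e i + rk a) =
      Some (inl (bitB R (nth_block i) a)) :> option (bool + ntm_work N).
    by rewrite (nth_map false) // nth_encode_bit.
  apply/and5P; split; rewrite ?rel_pos // ?rel_blank ?rel_cell // /zeroB /succB /lastB.
  + by case: eqP => // ->; apply/implyP=> /eqP ->; apply/implyP.
  + apply/implyP=> /eqP pa; apply/implyP=> /eqP ->; apply/implyP=> /eqP ->.
    by rewrite pa addnS.
  + case: eqP => // Ei; apply/implyP=> /eqP pa; apply/implyP=> /eqP al.
    apply/implyP=> /eqP ->; rewrite pa -addnS al ai -offsetS Ei.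
    by rewrite (offset_end R e_uniq e_all).
  + apply/implyP=> /eqP pa; apply/implyP=> /eqP tz; apply/implyP=> ba.
    by rewrite tz cs0 /= pa cell ba.
  + rewrite andbT.
    apply/implyP=> /eqP pa; apply/implyP=> /eqP tz; apply/implyP=> ba.
    by rewrite tz cs0 /= pa cell (negbTE ba).
- move=> i j a a' p p' ai a'j pd p'd; rewrite /next_clause; case: eqP => // ji.
  rewrite !rel_pos // /lastB /zeroB /succB.
  apply/implyP=> /eqP pa; apply/implyP=> /eqP al; apply/implyP=> /eqP ->.
  by apply/implyP=> /eqP ->; rewrite pa -addnS al ai -offsetS ji addn0.
- move=> c b t p td pd; rewrite /choice_clause; case: ifP => // nacc.
  rewrite rel_state rel_head // rel_cell //.
  apply/implyP=> /andP[tt0 /eqP tc]; apply/implyP=> /andP[_ /eqP tp].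
  (* The configuration at [t0] accepts, so this nonaccepting one is earlier and has a successor in
     the run. *)
  apply/implyP=> /andP[_ /eqP tb]; have lt0 : rk t < t0.
    rewrite ltn_neqAle tt0 andbT; apply: contraNneq nacc => t0E.
    by rewrite -tc t0E.
  have [l tl] := step_transition (cs_step lt0).
  apply/hasP; exists l; last by rewrite rel_trans lt0; apply/asboolP.
  by rewrite mem_filter mem_enum andbT -tc -tb -tp; case: tl.
move=> l b t t' p p' td t'd pd p'd.
have next : rel (STrans _ l) t -> succB e t t' ->
    [/\ rk t < t0, rk t' <= t0 & cs (rk t') = Config l.1.1
      (fun i => if i == chead (cs (rk t)) then l.1.2 else ctape (cs (rk t)) i)
      (if l.2 then (chead (cs (rk t))).+1 else (chead (cs (rk t))).-1)].
  by rewrite rel_trans => /andP[lt0 /asboolP[_ E]] /eqP ->; split.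
apply/and5P; split; [| | | |apply/and3P; split=> //].
- by apply/implyP=> rl; apply/implyP=> /(next rl)[_ h E]; rewrite rel_state h E /=.
- apply/implyP=> rl; apply/implyP=> /(next rl)[_ h E].
  rewrite rel_head // rel_cell // h E; apply/implyP=> /andP[_ /eqP <-] /=.
  by rewrite eqxx.
- apply/implyP=> rl; apply/implyP=> /(next rl)[_ h E].
  rewrite rel_head // !rel_cell // h E; apply/implyP=> /andP[_ /eqP ph] /=.
  apply/implyP=> npp'; apply/implyP=> /andP[_ /eqP <-]; rewrite ph.
  case: (rk p' =P rk p) => [p'p|//]; case/negP: npp'; apply/eqP.
  by apply: (lrank_inj e_uniq e_all); rewrite ?pd ?p'd ?p'p.
- case: ifP => // l2; apply/implyP=> rl; apply/implyP=> /(next rl)[_ h E].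
  rewrite !rel_head // h E l2; apply/implyP=> /andP[_ /eqP ph] /=.
  by rewrite /succB ph; apply/implyP=> /eqP ->.
- case: ifP => // l2; apply/implyP=> rl; apply/implyP=> /(next rl)[_ h E].
  rewrite !rel_head // h E (negbTE l2); apply/implyP=> /andP[_ /eqP ->] /=.
  by apply/implyP=> /eqP ->.
- case: ifP => // l2; apply/implyP=> rl; apply/implyP=> /(next rl)[_ h E].
  rewrite !rel_head // h E (negbTE l2); apply/implyP=> /andP[_ /eqP ->] /=.
  by rewrite /zeroB; apply/implyP=> /eqP ->.
Qed.

End Complete.

(** * Assembling the two directions *)

Lemma steps_path (N : ntm) t (c c' : config N) : steps t c c' ->
  exists cs : nat -> config N,
    [/\ cs 0 = c, cs t = c' & forall i, i < t -> step (cs i) (cs i.+1)].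
Proof.
elim: t c => [|t IH] c /=; first by move=> <-; exists (fun=> c).
case=> c1 cc1 /IH[cs [cs0 cst css]].
exists (fun i => if i is i'.+1 then cs i' else c); split=> // -[_|i]; first by rewrite cs0.
exact: css.
Qed.

(** The empty team satisfies every formula, so for it the equivalence can hold only if the empty
    relation has the property; this is why [X] is nonempty or [C M set0] holds. *)
Theorem corollary6p4 (sg : signature) (k : nat) (C : team_property sg k)
    (v : k.-tuple nat) :
  0 < k -> closed_under_iso C -> NP (language C) -> uniq v ->
  exists phi : formula sg,
    formula_fv phi `<=` [set x | x \in v] /\
    forall (M : finModel sg) (V : set nat) (X : set (assignment M)),
      team_on V X -> [set x | x \in v] `<=` V ->
      X !=set0 \/ C M set0 ->
      (sat X phi <-> C M (team_rel v X)).
Proof.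
move=> _ Ciso [N [p [NT LN]]] _.
have [d dP] := time_bound sg k p.
pose m := \max_(i < size (blocks sg)) barity k (nth_block i).
(* Room for the longest argument lists: a tuple of the team relation, a time with a cell, a block
   entry with a position, and the two arguments of the order. *)
pose A := (k + d + d + m).+1.
have A0 : 0 < A by [].
have kA : k <= A.+1 by rewrite /A; lia.
have dA : d + d <= A.+1 by rewrite /A; lia.
have qA (i : 'I_(size (blocks sg))) : barity k (nth_block i) + d <= A.+1.
  have : barity k (nth_block i) <= m by exact: leq_bigmax.
  by rewrite /A; lia.
exists (skolem_formula (STeam sg N) (SZero sg N) v kA (fagin sg k N d A)).
split=> [|M V X XV vV]; first exact: prefixed_fv.
case: (pselect (X !=set0)) => [X0 _|/set0P/negP/negPn/eqP -> [[]//|C0]]; last first.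
  split=> _; last exact: sat_empty.
  by have -> : @team_rel M k v set0 = set0 by apply/seteqP; split=> // a [].
rewrite (skolem_expressible _ _ _ _ XV vV X0); set R := team_rel v X.
(* The enumeration is left open: one direction uses the guessed order, the other [enum M]. *)
have accE e : uniq e -> e =i predT -> accepts N (encode R e) <-> C M R.
  by move=> eu ea; rewrite -LN; apply: language_encode.
split.
  case=> F [RF /(fagin_runs A0 dA qA RF)[e eF run]]; have [eu ea _ _ _] := eF.
  apply/(accE e eu ea)/(runs_accept eu ea run NT).
  rewrite size_encode // (size_enumeration eu ea).
  by have [] := dP _ (dom_gt1 M).
have eu := enum_uniq M; have ea : enum M =i predT by move=> x; rewrite mem_enum.
move=> /(accE _ eu ea)[t [c [/steps_path[cs [cs0 <- css]] acc]]].
have /card_gt0P[m0 _] := ltnW (dom_gt1 M).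
exists (history d R (enum M) m0 cs t); split; first exact: history_team.
have run := history_runs d m0 eu ea cs0 css acc.
apply: (runs_fagin A0 dA qA (history_team d R m0 eu ea cs t) _ _ run).
  exact: history_order.
exact: history_order_clauses.
Qed.
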